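(* Let $(\Omega,\Sigma,m)$ be a compact Borel probability space whose topology is induced by a metric, let $b>0$, and let $A^n$ ($n\in\mathbb{N}$) and $A$ be graphops in $\mathcal{G}^m$ with extensions $\mathcal{A}^n$, $\mathcal{A}$. For an initial condition $\bar\mu_0\in\bar{\mathcal{M}}^b$ let $\mu^n,\mu\in\mathcal{M}^b_{\mathcal{T}}$ be the solutions of the fixed point equations $$\mu^{n,y}_t=\mu_0^y\circ T_{0,t}[\mathcal{A}^n,\mu^n,y],\qquad \mu^y_t=\mu_0^y\circ T_{0,t}[\mathcal{A},\mu,y]\qquad\text{for all }y\in\Omega,\ t\in\mathcal{T}.$$ Assume that $A^n\to_oA$ and that $\|A\|_{1\to q}<\infty$ for some $q\in[1,\infty]$. Further assume that for any Borel set $S\subset\mathbb{T}$ with $\lambda(\partial S)=0$ and any $t\in[0,T]$, the function $x\mapsto\mu^x_t(S)$ is bounded and its set $U$ of discontinuity points satisfies $m(U)=0$. Then $$\sup_{t\in\mathcal{T}}\bar d^{b,m}(\bar\mu^n_t,\bar\mu_t)\to0\qquad\text{as }n\to\infty.$$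
   Context: Graphops. A compact Borel probability space $(\Omega,\Sigma,m)$ consists of a compact space $\Omega$, its Borel $\sigma$-algebra $\Sigma$ and a probability measure $m$. A graphop on it is a linear operator $A:L^\infty(\Omega,m)\to L^1(\Omega,m)$ with $\sup_v\|Av\|_1/\|v\|_\infty<\infty$, which is positivity preserving ($v\ge0$ $m$-a.e. implies $Av\ge0$ $m$-a.e.) and self-adjoint ($\int (Av)w\,\mathrm{d}m=\int v(Aw)\,\mathrm{d}m$ for all $v,w\in L^\infty$). Every graphop has a (measurable) family of finite measures $\{\nu_x^A\}_{x\in\Omega}$ on $\Omega$, the fiber measures, with $(Af)(x)=\int_\Omega f(y)\,\mathrm{d}\nu_x^A(y)$ for $m$-a.e. $x$ and all $f\in L^\infty(\Omega,m)$. Fixed representatives, defined for every $x\in\Omega$, are used. $\gamma_A:=\sup_{x\in\Omega}\nu_x^A(\Omega)$. $\mathcal{G}^m$ is the set of graphops $B$ on $(\Omega,\Sigma,m)$ with $\gamma_B\le1$; $\mathcal{G}$ is the set of graphops $B$ on $(\Omega,\Sigma,l)$, for arbitrary probability measures $l$ on $(\Omega,\Sigma)$, with $\gamma_B\le1$. Norms: $\|A\|_{p\to q}=\sup_{v\in L^\infty(\Omega)}\|Av\|_q/\|v\|_p$. Convergence: $A^n\to_oA$ means that for $m$-a.e. $x\in\Omega$ the fiber measures $\nu_x^{A^n}$ converge weakly to $\nu_x^A$. Measure spaces. $\mathbb{T}=[0,2\pi)$ regarded as the circle, $|u-v|$ the distance on it, $\lambda$ Lebesgue measure on $\mathbb{T}$.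 $\mathcal{M}_f(\mathbb{T})$ is the set of finite Borel measures on $\mathbb{T}$ with $d_{BL}(\mu,\nu)=\sup_{f\in\mathcal{L}}|\int_{\mathbb{T}}f\,\mathrm{d}(\mu-\nu)|$, $\mathcal{L}$ the set of Lipschitz $f:\mathbb{T}\to[0,1]$ with Lipschitz constant $\le1$. $\bar{\mathcal{M}}^b$ is the set of measurable $\bar\mu:\Omega\to\mathcal{M}_f(\mathbb{T})$, $x\mapsto\mu^x$, with $\sup_x\mu^x(\mathbb{T})\le b$, with metric $\bar d^b(\bar\mu,\bar\kappa)=\sup_{B\in\mathcal{G}}\sup_{x\in\Omega}\int_\Omega d_{BL}(\mu^y,\kappa^y)\,\mathrm{d}\nu_x^B(y)$, and pseudometric $\bar d^{b,m}(\bar\mu,\bar\kappa)=\int_\Omega d_{BL}(\mu^y,\kappa^y)\,\mathrm{d}m(y)$. Fix $T>0$, $\mathcal{T}=[0,T]$; $\mathcal{M}^b_{\mathcal{T}}=C(\mathcal{T},(\bar{\mathcal{M}}^b,\bar d^b))$. Field and flow. $C>0$ is a constant and $D:\mathbb{T}\to\mathbb{R}$ satisfies $|D(u)-D(v)|\le|u-v|$ and $\max|D|\le1$. For a graphop $A$, its extension is $(\mathcal{A}\mu)^x(S)=\int_\Omega\mu^y(S)\,\mathrm{d}\nu_x^A(y)$ for Borel $S\subset\mathbb{T}$. For $\mu\in\mathcal{M}^b_{\mathcal{T}}$, $x\in\Omega$, $V[\mathcal{A},\mu,x](t,u)=C\int_0^{2\pi}D(\tilde u-u)\,\mathrm{d}(\mathcal{A}\mu_t)^x(\tilde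 u)$. $T_{t,t_0}[\mathcal{A},\mu,x]:\mathbb{T}\to\mathbb{T}$ maps $P_0$ to $P(t)$, where $\frac{\mathrm{d}P}{\mathrm{d}t}=V[\mathcal{A},\mu,x](t,P)$, $P(t_0)=P_0$; $\mu_0^y\circ T_{0,t}$ is the measure $S\mapsto\mu_0^y(T_{0,t}(S))$. The fixed point equations have unique solutions in $\mathcal{M}^b_{\mathcal{T}}$ for graphops in $\mathcal{G}^m$. *)

(* Defs.v *)
From HB Require Import structures.
From mathcomp Require Import all_boot all_order all_algebra.
From mathcomp Require Import all_classical all_reals all_analysis.
From mathcomp Require Import lra.

Set Implicit Arguments.
Unset Strict Implicit.
Unset Printing Implicit Defensive.

Import Order.TTheory GRing.Theory Num.Theory.
Import numFieldNormedType.Exports.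

Local Open Scope classical_set_scope.
Local Open Scope ring_scope.

HB.mixin Record isBorel d T & SemiRingOfSets d T & Topological T := {
  measurable_borelE : @measurable d T = <<s (@open T) >>
}.

#[short(type="borelMetricType")]
HB.structure Definition BorelMetric d (R : realType) :=
  { T of Measurable d T & Metric R T & isBorel d T }.

Section circle.
Variable R : realType.

(* R / 2 pi Z, represented by [0, 2 pi) with the arc-length distance; its
   topology is that of the circle, not the one induced by [0, 2 pi) in R. *)
Record circle := Circle { angle : R ; angleP : 0 <= angle < 2 * pi }.

HB.instance Definition _ := [isSub for angle].
HB.instance Definition _ := [Choice of circle by <:].

Lemma twopi_gt0 : 0 < 2 * pi :> R.
Proof. by rewrite mulr_gt0 ?pi_gt0. Qed.

Lemma circle0_subproof : 0 <= (0 : R) < 2 * pi.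
Proof. by rewrite lexx twopi_gt0. Qed.

HB.instance Definition _ := isPointed.Build circle (Circle circle0_subproof).

Definition reduce (x : R) : R := x - (2 * pi) * (Num.floor (x / (2 * pi)))%:~R.

Lemma reduceP x : 0 <= reduce x < 2 * pi.
Proof.
have p0 := twopi_gt0; rewrite /reduce.
have /andP[h1 h2] := floor_itv (x / (2 * pi)).
have xE : x = 2 * pi * (x / (2 * pi)) by rewrite mulrC mulfVK// gt_eqF.
rewrite [X in X - _]xE -mulrBr; apply/andP; split.
  by rewrite mulr_ge0 ?(ltW p0)// subr_ge0.
by rewrite -[ltRHS]mulr1 ltr_pM2l// ltrBlDl -[1]mulr1z -intrD.
Qed.

Definition toCircle (x : R) : circle := Circle (reduceP x).

Definition csub (u v : circle) : circle := toCircle (angle u - angle v).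

Definition cdist (u v : circle) : R :=
  Num.min `|angle u - angle v| (2 * pi - `|angle u - angle v|).

Lemma cdistxx u : cdist u u = 0.
Proof.
by rewrite /cdist subrr normr0 subr0; apply/min_idPl; rewrite ltW// twopi_gt0.
Qed.

Lemma cdist_eq0 u v : cdist u v = 0 -> u = v.
Proof.
have /andP[u0 u1] := angleP u; have /andP[v0 v1] := angleP v.
rewrite /cdist minEle => h; apply: val_inj => /=; move: h.
case: ifPn => _; first by move/normr0_eq0/eqP; rewrite subr_eq0 => /eqP.
by case: ler0P => _; lra.
Qed.

Lemma cdistC u v : cdist u v = cdist v u.
Proof. by rewrite /cdist distrC. Qed.

Lemma cdist_triangle v u w : cdist u w <= cdist u v + cdist v w.
Proof.
have /andP[u0 u1] := angleP u; have /andP[v0 v1] := angleP v.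
have /andP[w0 w1] := angleP w; rewrite /cdist !minEle.
by do 3![case: ler0P => ?]; do 3![case: ifP => [|/negbT]; rewrite -?ltNge => ?];
  lra.
Qed.

HB.instance Definition _ :=
  isMetric.Build R circle cdistxx cdist_eq0 cdistC cdist_triangle.

HB.instance Definition _ := @isMeasurable.Build (sigma_display (@open circle))
  circle <<s (@open circle) >> (@sigma_algebra0 _ setT _)
  (@sigma_algebraC _ (@open circle)) (@sigma_algebra_bigcup _ setT _).

Definition finmeas : Type := {finite_measure set circle -> \bar R}.

HB.instance Definition _ := gen_eqMixin finmeas.
HB.instance Definition _ := gen_choiceMixin finmeas.
HB.instance Definition _ := isPointed.Build finmeas mzero.

End circle.

Section graphop.
Context d (Omega : measurableType d) (R : realType).
Variable m : probability Omega R.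

Local Notation Linf := (LfunType m (leey 1%E)).
Local Notation L1 := (LfunType m (lexx 1%E)).

(* The supremum runs over nonzero classes, where the quotient makes sense. *)
Definition opnorm (op : Linf -> L1) (p q : \bar R) : \bar R :=
  ereal_sup [set ('N[m]_q[EFin \o op v] / 'N[m]_p[EFin \o v])%E
            | v in [set v : Linf | 'N[m]_p[EFin \o v]%E != 0%E]].

(* The operator acts on representatives: [graphop_ae] and [graphop_linear] say
   that it is well defined and linear on a.e. classes, i.e. from L^oo to L^1.
   The fiber measures are part of the data, as a fixed representative defined
   at every point. *)
Record graphop := Graphop {
  graphop_fun : Linf -> L1 ;
  graphop_ae : forall v w : Linf,
    {ae m, forall x, v x = w x} ->
    {ae m, forall x, graphop_fun v x = graphop_fun w x} ;
  graphop_linear : forall (a : R) (v w : Linf),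
    {ae m, forall x,
      graphop_fun (a *: v + w) x = a * graphop_fun v x + graphop_fun w x} ;
  graphop_bounded : (opnorm graphop_fun +oo 1 < +oo)%E ;
  graphop_pos : forall v : Linf,
    {ae m, forall x, 0 <= v x} -> {ae m, forall x, 0 <= graphop_fun v x} ;
  graphop_selfadjoint : forall v w : Linf,
    (\int[m]_x (graphop_fun v x * w x)%:E =
     \int[m]_x (v x * graphop_fun w x)%:E)%E ;
  fiber : R.-ftker Omega ~> Omega ;
  graphop_fiber : forall v : Linf,
    {ae m, forall x, (graphop_fun v x)%:E = (\int[fiber x]_y (v y)%:E)%E}
}.

Definition gamma (A : graphop) : \bar R :=
  ereal_sup (range (fun x => fiber A x setT)).

End graphop.

Section weak_convergence.
Context d (R : realType) (Omega : borelMetricType d R).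

Definition weak_cvg (nu_ : nat -> {measure set Omega -> \bar R})
    (nu : {measure set Omega -> \bar R}) : Prop :=
  forall f : Omega -> R, continuous f -> [bounded f x | x in [set: Omega]] ->
    (\int[nu_ n]_x (f x)%:E)%E @[n --> \oo] --> (\int[nu]_x (f x)%:E)%E.

Definition graphop_cvg (m : probability Omega R) (A_ : nat -> graphop m)
    (A : graphop m) : Prop :=
  {ae m, forall x, weak_cvg (fun n => fiber (A_ n) x) (fiber A x)}.

End weak_convergence.

Section measure_valued.
Context d (Omega : measurableType d) (R : realType).
Local Notation circle := (circle R).
Local Notation finmeas := (finmeas R).

Definition lambda (S : set circle) : \bar R := lebesgue_measure (@angle R @` S).

Definition boundary (S : set circle) : set circle := closure S `\` S^°.

Definition BL1 : set (circle -> R) :=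
  [set f | (forall u, 0 <= f u <= 1) /\
           (forall u v, `|f u - f v| <= mdist u v)].

Definition dBL (mu nu : finmeas) : \bar R :=
  ereal_sup [set `|\int[mu]_u (f u)%:E - \int[nu]_u (f u)%:E|%E | f in BL1].

Definition BL_open : set (set finmeas) :=
  [set U | forall mu, U mu ->
     exists2 e : R, 0 < e & forall nu, (dBL mu nu < e%:E)%E -> U nu].

Definition Mbar (b : R) : set (Omega -> finmeas) :=
  [set mu | measurable_fun setT (mu : Omega -> g_sigma_algebraType BL_open) /\
            forall x, (mu x setT <= b%:E)%E].

Definition dbar (mu kappa : Omega -> finmeas) : \bar R :=
  ereal_sup [set r | exists (l : probability Omega R) (B : graphop l) (x : Omega),
     (gamma B <= 1)%E /\ r = (\int[fiber B x]_y dBL (mu y) (kappa y))%E].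

Definition dbarm (m : probability Omega R) (mu kappa : Omega -> finmeas) : \bar R :=
  (\int[m]_y dBL (mu y) (kappa y))%E.

(* Continuous curves [0, T] -> (Mbar b, dbar); values outside [0, T] are
   irrelevant. *)
Definition MbarT (b T : R) : set (R -> Omega -> finmeas) :=
  [set mu | forall t, 0 <= t <= T -> Mbar b (mu t) /\
     dbar (mu s) (mu t) @[s --> within `[0, T] (nbhs t)] --> 0%E].

End measure_valued.

Section flow.
Context d (Omega : measurableType d) (R : realType) (m : probability Omega R).
Local Notation circle := (circle R).
Local Notation finmeas := (finmeas R).
Variables (T C : R) (D : circle -> R).

(* S |-> \int mu^y(S) d nu_x^A(y), a measure as soon as mu is in [Mbar b]; the
   library integral only needs the underlying set function. *)
Definition extension (A : graphop m) (mu : Omega -> finmeas) (x : Omega) :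
    set circle -> \bar R :=
  kcomp_noparam (fiber A) (fun y => mu y) x.

Definition velocity (A : graphop m) (mu : R -> Omega -> finmeas) (x : Omega)
    (t : R) (u : circle) : R :=
  C * fine (\int[extension A (mu t) x]_v (D (csub v u))%:E)%E.

(* [p] is a real lift of a solution P : [0, T] -> circle of dP/dt = V(t, P). *)
Definition trajectory (V : R -> circle -> R) (p : R -> R) : Prop :=
  {within `[0, T], continuous p} /\
  {in `]0, T[, forall t : R, is_derive t 1 p (V t (toCircle (p t)))}.

(* The map T_{t,t0}: the state at time t of the solution equal to P0 at t0. *)
Definition flow (V : R -> circle -> R) (t t0 : R) (P0 : circle) : circle :=
  get [set P | exists p, [/\ trajectory V p,
                             toCircle (p t0) = P0 & toCircle (p t) = P]].

(* mu_t^y = mu_0^y o T_{0,t}, the right-hand side being the measure of the direct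
   image of S under T_{0,t}. *)
Definition fixed_point (A : graphop m) (mu0 : Omega -> finmeas)
    (mu : R -> Omega -> finmeas) : Prop :=
  forall y t, 0 <= t <= T -> forall S : set circle, measurable S ->
    mu t y S = mu0 y (flow (velocity A mu y) 0 t @` S).

End flow.

(* Main.v *)
From HB Require Import structures.
Require Import Defs.
From mathcomp Require Import all_boot all_order all_algebra.
From mathcomp Require Import all_classical all_reals all_analysis.
From mathcomp Require Import measurable_realfun ess_sup_inf.
From mathcomp Require Import lra ring.

Set Implicit Arguments.
Unset Strict Implicit.
Unset Printing Implicit Defensive.

Import Order.TTheory GRing.Theory Num.Theory.
Import numFieldNormedType.Exports.

Local Open Scope classical_set_scope.
Local Open Scope ring_scope.

(** A solution at [y] is the image of the initial measure under the forward flow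
    of its own velocity field, so the distance of two solutions with the same
    initial measure is controlled by the gap between the lifted flows.  On a time
    grid of step [h] the gap over [A_ n] and [A] is dominated by functions [G_ j]
    with [G_ j.+1 = G_ j + h (L G_ j + L \int G_ j dnu^n + source_ j)], where
    [source_ j] compares the integrals of [y |-> mu t_j y S] against the fibers of
    [A_ n] and [A] for finitely many arcs [S], up to terms that are small with [h]
    and with the length of the arcs.  Self-adjointness and [gamma <= 1] give
    [\int \int G dnu_x dm <= \int G dm] for [G >= 0]; hence almost no fiber
    charges the null set of discontinuities, the sources tend to 0 in [L^1(m)] by
    the portmanteau theorem and dominated convergence, and the discrete Gronwall
    lemma applied to [\int G_ j dm] concludes. *)

(** * The circle *)

(** For the largest gap over all starting points at [y], and for [dBL] between two solutions,
    measurability in [y] is not established. So neither is handled by the usual integral calculus: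
    the [G_ j] are measurable by construction and dominate the gap at every [y] and every starting
    point at once, and [dBL] enters only through monotonicity of the integral. Smallness of the
    sources is obtained for one set and one time at a time, with a null set for each. Arcs and grid
    times must therefore be finite in number and fixed before [n]. Two uniformities allow this: one
    family of arcs approximates the kernels [D (csub v u)] equally well for all [u], and all
    trajectories move with speed at most [C * b], whatever [n] is. The fixed point equation is
    stated with direct images under the backward flow; reading it as an image measure under the
    forward flow takes existence, uniqueness and surjectivity of the flow, which are proved on real
    lifts, where trajectories can be differentiated and subtracted. *)

Section circle_geometry.
Context {R : realType}.
Implicit Types (u v w : circle R) (x y z : R).

Lemma mdist_circleE u v : mdist u v = cdist u v.
Proof. by []. Qed.

Lemma reduceE x : reduce x = x - 2 * pi * (Num.floor (x / (2 * pi)))%:~R.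
Proof. by []. Qed.

Lemma toCircle_eq x y (k : int) : y = x + 2 * pi * k%:~R ->
  toCircle x = toCircle y.
Proof.
move=> ->; apply: val_inj => /=; rewrite !reduceE.
have p0 := twopi_gt0 R.
have -> : (x + 2 * pi * k%:~R) / (2 * pi) = x / (2 * pi) + k%:~R.
  by rewrite [LHS]mulrDl [X in _ + X]mulrAC divff ?gt_eqF// mul1r.
rewrite floorDrz ?intr_int// intrKfloor intrD mulrDr; lra.
Qed.

Lemma toCircleK u : toCircle (angle u) = u.
Proof.
apply: val_inj => /=; rewrite reduceE.
have /andP[u0 u1] := angleP u; have p0 := twopi_gt0 R.
suff -> : Num.floor (angle u / (2 * pi)) = 0 by rewrite mulr0 subr0.
apply/eqP; rewrite floor_eq ?num_real//.
by rewrite divr_ge0 ?(ltW p0)//= add0r ltr_pdivrMr// mul1r.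
Qed.

Lemma toCircle_inj x y : toCircle x = toCircle y ->
  exists k : int, y = x + 2 * pi * k%:~R.
Proof.
move=> /(congr1 (@angle R)); rewrite /= !reduceE => xy.
exists (Num.floor (y / (2 * pi)) - Num.floor (x / (2 * pi))).
by rewrite intrB mulrBr; lra.
Qed.

(** Among the lifts of [v], the nearest to [x] is the one in the period of [x] or a neighbour of it
    by one turn. With [mdist_toCircle] this moves Lipschitz estimates between the circle and the
    real line. *)
Lemma cdist_lift x v : exists2 y, toCircle y = v & `|x - y| = mdist (toCircle x) v.
Proof.
have /toCircle_inj[k xE] : toCircle x = toCircle (angle (toCircle x)).
  by rewrite toCircleK.
set a := angle (toCircle x) in xE *; rewrite mdist_circleE /cdist -/a.
pose b := angle v.
have shift (j : int) : toCircle (b - 2 * pi * k%:~R + 2 * pi * j%:~R) = v.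
  rewrite -[RHS]toCircleK; apply: (@toCircle_eq _ _ (k - j)).
  by rewrite intrB mulrBr /b; lra.
have /andP[u0 u1] := angleP (toCircle x); have /andP[v0 v1] := angleP v.
rewrite -/a -/b in u0 u1 v0 v1 *; rewrite minEle.
case: ifPn => [_|].
  exists (b - 2 * pi * k%:~R + 2 * pi * 0%:~R) => //.
  by rewrite mulr0 xE; congr `|_|; lra.
rewrite -ltNge => h; have [ab|ab] := leP a b.
  exists (b - 2 * pi * k%:~R + 2 * pi * (-1)%:~R) => //.
  have -> : x - (b - 2 * pi * k%:~R + 2 * pi * (-1)%:~R) = 2 * pi + (a - b).
    by rewrite xE mulrN1; lra.
  by rewrite [in RHS]distrC !ger0_norm ?subr_ge0//; lra.
exists (b - 2 * pi * k%:~R + 2 * pi * 1%:~R) => //.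
have -> : x - (b - 2 * pi * k%:~R + 2 * pi * 1%:~R) = - (2 * pi - (a - b)).
  by rewrite xE mulr1; lra.
by rewrite normrN !ger0_norm ?subr_ge0//; lra.
Qed.

Lemma mdist_toCircle x y : mdist (toCircle x) (toCircle y) <= `|x - y|.
Proof.
wlog: x y / angle (toCircle y) <= angle (toCircle x).
  move=> h; have [|/ltW] := leP (angle (toCircle y)) (angle (toCircle x)).
    exact: h.
  by move=> /h; rewrite metric_sym distrC.
have /toCircle_inj[k xE] : toCircle x = toCircle (angle (toCircle x)).
  by rewrite toCircleK.
have /toCircle_inj[l yE] : toCircle y = toCircle (angle (toCircle y)).
  by rewrite toCircleK.
rewrite mdist_circleE /cdist.
have /andP[u0 u1] := angleP (toCircle x).
have /andP[v0 v1] := angleP (toCircle y).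
set a := angle (toCircle x) in xE u0 u1 *.
set b := angle (toCircle y) in yE v0 v1 *.
move=> ba; have p0 := twopi_gt0 R.
have -> : x - y = a - b + 2 * pi * (l - k)%:~R.
  by rewrite intrB xE yE; lra.
rewrite (ger0_norm (_ : 0 <= a - b)) ?subr_ge0// ge_min.
(* The integer [l - k] is nonnegative or at most -1: the first case gives [a - b] as a lower bound
   of the real distance, the second gives [2 * pi - (a - b)]. *)
have [lk|lk] := leP 0 (l - k).
  have h : 0 <= 2 * pi * (l - k)%:~R :> R by rewrite mulr_ge0 ?ler0z// ltW.
  by apply/orP; left; rewrite ger0_norm; lra.
have h : 2 * pi * (l - k)%:~R <= - (2 * pi) :> R.
  rewrite -[leRHS]mulr1 mulNr -mulrN ler_pM2l// -[X in _ <= - X]mulr1z -mulrNz.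
  by rewrite ler_int -ltzD1 addNr.
by apply/orP; right; rewrite ler0_norm; lra.
Qed.

Lemma csub_toCircle x y : csub (toCircle x) (toCircle y) = toCircle (x - y).
Proof.
have /toCircle_inj[k xE] : toCircle x = toCircle (angle (toCircle x)).
  by rewrite toCircleK.
have /toCircle_inj[l yE] : toCircle y = toCircle (angle (toCircle y)).
  by rewrite toCircleK.
rewrite /csub xE yE; apply: (@toCircle_eq _ _ (l - k)).
by rewrite intrB mulrBr; lra.
Qed.

Lemma mdist_csubl v u w : mdist (csub u v) (csub w v) <= mdist u w.
Proof.
rewrite -[u]toCircleK; have [y <- <-] := cdist_lift (angle u) w.
rewrite -[v]toCircleK !csub_toCircle (le_trans (mdist_toCircle _ _))//.
by rewrite opprB addrA addrNK.
Qed.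

Lemma mdist_csubr v u w : mdist (csub v u) (csub v w) <= mdist u w.
Proof.
rewrite -[u]toCircleK; have [y <- <-] := cdist_lift (angle u) w.
rewrite -[v]toCircleK !csub_toCircle (le_trans (mdist_toCircle _ _))//.
by rewrite distrC opprB addrC subrKA.
Qed.

End circle_geometry.

(** * Integrals of bounded measurable functions *)

Section bounded_measurable.
Context {d} {T : measurableType d} {R : realType}.
Implicit Types (f g : T -> R) (mu : {measure set T -> \bar R}).

(** The bound holds everywhere, not almost everywhere, because the same function is integrated
    against [m] and against every fiber; it is then integrable for all these finite measures at
    once. *)
Definition bmfun f :=
  measurable_fun setT f /\ exists M, forall x, `|f x| <= M.

Lemma bmfun_cst (c : R) : bmfun (fun _ => c).
Proof. by split; [exact: measurable_cst|exists `|c|]. Qed.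

Lemma bmfunD f g : bmfun f -> bmfun g -> bmfun (fun x => f x + g x).
Proof.
move=> [mf [M fM]] [mg [N gN]]; split; first exact: measurable_funD.
by exists (M + N) => x; rewrite (le_trans (ler_normD _ _))// lerD.
Qed.

Lemma bmfunM f g : bmfun f -> bmfun g -> bmfun (fun x => f x * g x).
Proof.
move=> [mf [M fM]] [mg [N gN]]; split; first exact: measurable_funM.
by exists (M * N) => x; rewrite normrM ler_pM.
Qed.

Lemma bmfunZ (c : R) f : bmfun f -> bmfun (fun x => c * f x).
Proof. by apply: bmfunM; exact: bmfun_cst. Qed.

Lemma bmfunN f : bmfun f -> bmfun (fun x => - f x).
Proof.
by move=> [mf [M fM]]; split; [exact: measurable_funN|exists M => x; rewrite normrN].
Qed.

Lemma bmfunB f g : bmfun f -> bmfun g -> bmfun (fun x => f x - g x).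
Proof. by move=> bf bg; apply: bmfunD => //; exact: bmfunN. Qed.

Lemma bmfun_norm f : bmfun f -> bmfun (fun x => `|f x|).
Proof.
move=> [mf [M fM]]; split; first exact: measurableT_comp.
by exists M => x; rewrite normr_id.
Qed.

Lemma bmfun_sum I (s : seq I) (F : I -> T -> R) :
  (forall i, bmfun (F i)) -> bmfun (fun x => \sum_(i <- s) F i x).
Proof.
move=> bF; elim: s => [|i s ih].
  rewrite (_ : (fun _ => _) = (fun=> 0)); first exact: bmfun_cst.
  by apply/funext => x; rewrite big_nil.
rewrite (_ : (fun _ => _) = (fun x => F i x + \sum_(j <- s) F j x)).
  exact: bmfunD.
by apply/funext => x; rewrite big_cons.
Qed.

Lemma bmfun_indic (A : set T) : measurable A -> bmfun (\1_A : T -> R).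
Proof.
move=> mA; split; first exact: measurable_indic.
by exists 1 => x; rewrite indicE; case: (_ \in _); rewrite ?normr1 ?normr0.
Qed.

Lemma bmfun_integrable mu f : (mu setT < +oo)%E -> bmfun f ->
  mu.-integrable setT (EFin \o f).
Proof.
move=> fmu [mf [M fM]]; apply: measurable_bounded_integrable => //.
by exists M; split; [exact: num_real|move=> N MN x _ /=; rewrite (le_trans (fM x)) ?ltW].
Qed.

Lemma EFin_Rintegral mu f : (mu setT < +oo)%E -> bmfun f ->
  (\int[mu]_x f x)%:E = (\int[mu]_x (f x)%:E)%E.
Proof.
move=> fmu bf; rewrite /Rintegral fineK//.
exact/integrable_fin_num/bmfun_integrable.
Qed.

Lemma bm_RintegralD mu f g : (mu setT < +oo)%E -> bmfun f -> bmfun g ->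
  \int[mu]_x (f x + g x) = \int[mu]_x f x + \int[mu]_x g x.
Proof. by move=> fmu bf bg; rewrite RintegralD//; exact: bmfun_integrable. Qed.

Lemma bm_RintegralB mu f g : (mu setT < +oo)%E -> bmfun f -> bmfun g ->
  \int[mu]_x (f x - g x) = \int[mu]_x f x - \int[mu]_x g x.
Proof. by move=> fmu bf bg; rewrite RintegralB//; exact: bmfun_integrable. Qed.

Lemma bm_RintegralZ mu (c : R) f : (mu setT < +oo)%E -> bmfun f ->
  \int[mu]_x (c * f x) = c * \int[mu]_x f x.
Proof. by move=> fmu bf; rewrite RintegralZl//; exact: bmfun_integrable. Qed.

Lemma bm_RintegralN mu f : (mu setT < +oo)%E -> bmfun f ->
  \int[mu]_x (- f x) = - \int[mu]_x f x.
Proof.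
move=> fmu bf; rewrite -mulN1r -bm_RintegralZ//.
by apply: eq_Rintegral => x _; rewrite mulN1r.
Qed.

Lemma bm_Rintegral_sum mu I (s : seq I) (F : I -> T -> R) : (mu setT < +oo)%E ->
  (forall i, bmfun (F i)) ->
  \int[mu]_x (\sum_(i <- s) F i x) = \sum_(i <- s) \int[mu]_x F i x.
Proof.
move=> fmu bF; elim: s => [|i s ih].
  rewrite big_nil (@eq_Rintegral _ _ _ _ _ (fun=> 0)); last first.
    by move=> x _; rewrite big_nil.
  by rewrite Rintegral_cst// mul0r.
rewrite big_cons -ih -bm_RintegralD//; last exact: bmfun_sum.
by apply: eq_Rintegral => x _; rewrite big_cons.
Qed.

Lemma bm_le_Rintegral mu f g : (mu setT < +oo)%E -> bmfun f -> bmfun g ->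
  (forall x, f x <= g x) -> \int[mu]_x f x <= \int[mu]_x g x.
Proof.
by move=> fmu bf bg fg; apply: le_Rintegral => //; exact: bmfun_integrable.
Qed.

Lemma bm_norm_Rintegral mu f : (mu setT < +oo)%E -> bmfun f ->
  `|\int[mu]_x f x| <= \int[mu]_x `|f x|.
Proof.
by move=> fmu bf; apply: le_normr_Rintegral => //; exact: bmfun_integrable.
Qed.

Lemma Rintegral_norm_le mu f (b M : R) : (mu setT <= b%:E)%E -> bmfun f ->
  (forall x, `|f x| <= M) -> `|\int[mu]_x f x| <= M * b.
Proof.
move=> mub bf fM; have fmu : (mu setT < +oo)%E by exact: le_lt_trans (ltry b).
rewrite (le_trans (bm_norm_Rintegral fmu bf))//.
rewrite (@le_trans _ _ (\int[mu]_x M))//.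
  by apply: bm_le_Rintegral => //; [exact: bmfun_norm|exact: bmfun_cst].
rewrite Rintegral_cst// ler_wpM2l//; first exact: le_trans (fM point).
by rewrite -lee_fin fineK// ge0_fin_numE.
Qed.

Lemma Rintegral_bounded_cvg mu (f_ : nat -> T -> R) f (M : R) :
  (mu setT < +oo)%E -> (forall n, measurable_fun setT (f_ n)) -> bmfun f ->
  (forall n x, `|f_ n x| <= M) -> {ae mu, forall x, f_ n x @[n --> \oo] --> f x} ->
  \int[mu]_x f_ n x @[n --> \oo] --> \int[mu]_x f x.
Proof.
move=> fmu mf_ bf fM ff.
have ffE : {ae mu, forall x, setT x -> (f_ n x)%:E @[n --> \oo] --> (f x)%:E}.
  apply: filterS ff => x h _; apply/fine_cvgP; split; last exact: h.
  by apply: nearW => n.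
have [] := @dominated_convergence _ T R mu setT measurableT
  (fun n x => (f_ n x)%:E) (fun x => (f x)%:E) (fun=> M%:E) _ _ ffE.
- by move=> n; exact/measurable_EFinP.
- exact/measurable_EFinP/bf.1.
- exact: (bmfun_integrable fmu (bmfun_cst M)).
- by apply: aeW => x n _; rewrite lee_fin.
by move=> _ _; rewrite -EFin_Rintegral// => /fine_cvg; exact.
Qed.

End bounded_measurable.

Section lower_integral.
Context {d} {T : measurableType d} {R : realType}.
Variable mu : {measure set T -> \bar R}.

(** The integral of a nonnegative function is a supremum over the simple functions below it, so
    monotonicity requires no measurability. This is what allows integrals of [dBL] to be
    estimated. *)
Lemma ge0_le_lower_integral (f g : T -> \bar R) : (forall x, 0 <= f x)%E ->
  (forall x, f x <= g x)%E -> (\int[mu]_x f x <= \int[mu]_x g x)%E.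
Proof.
move=> f0 fg; have g0 x : (0 <= g x)%E by exact: le_trans (fg x).
rewrite !ge0_integralTE//; apply: le_ereal_sup => _ [h hf <-]; exists h => // x.
exact: le_trans (hf x) (fg x).
Qed.

End lower_integral.

(** * Ordinary differential equations *)

Section derivative_comparison.
Context {R : realType}.

(** Both [phi + w] and [phi - w] have nonnegative derivative, so the mean value theorem suffices and
    [dw] need not be integrable. *)
Lemma dist_le_primitive (w dw phi dphi : R -> R) (a b : R) : a <= b ->
  {within `[a, b], continuous w} -> {within `[a, b], continuous phi} ->
  (forall t, t \in `]a, b[ -> is_derive t 1 w (dw t)) ->
  (forall t, t \in `]a, b[ -> is_derive t 1 phi (dphi t)) ->
  (forall t, t \in `]a, b[ -> `|dw t| <= dphi t) ->
  `|w b - w a| <= phi b - phi a.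
Proof.
rewrite le_eqVlt => /predU1P[->|ab]; first by rewrite !subrr normr0.
move=> cw cphi ww pp h; rewrite ler_norml; apply/andP; split.
- have [t tab E] := MVT ab (fun t tab => is_deriveD (pp t tab) (ww t tab))
    (fun x => cvgD (cphi x) (cw x)).
  have : 0 <= (phi \+ w) b - (phi \+ w) a.
    rewrite E mulr_ge0 ?subr_ge0 ?(ltW ab)//.
    by have := h t tab; rewrite ler_norml => /andP[]; lra.
  by rewrite /=; lra.
- have [t tab E] := MVT ab (fun t tab => is_deriveB (pp t tab) (ww t tab))
    (fun x => cvgB (cphi x) (cw x)).
  have : 0 <= (phi \- w) b - (phi \- w) a.
    rewrite E mulr_ge0 ?subr_ge0 ?(ltW ab)//.
    by have := h t tab; rewrite ler_norml => /andP[]; lra.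
  by rewrite /=; lra.
Qed.

(* [w ^ 2 * expR (- 2 L t)] decreases and [w ^ 2 * expR (2 L t)] increases. *)
Lemma gronwall_le (w dw : R -> R) (L a b : R) : 0 <= L -> a <= b ->
  {within `[a, b], continuous w} ->
  (forall t, t \in `]a, b[ -> is_derive t 1 w (dw t)) ->
  (forall t, t \in `]a, b[ -> `|dw t| <= L * `|w t|) ->
  `|w b| <= `|w a| * expR (L * (b - a)) /\ `|w a| <= `|w b| * expR (L * (b - a)).
Proof.
move=> L0 ab cw ww h.
have dE (c t : R) : is_derive t 1 (fun s => expR (c * s)) (c * expR (c * t)).
  have hg : is_derive t 1 (fun s : R => c * s) c.
    by apply: is_derive_eq; rewrite /GRing.scale /= mulr1.
  by apply: is_derive_eq; rewrite mulrC.
have cE (c : R) : {within `[a, b], continuous (fun s => expR (c * s))}.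
  apply: continuous_subspaceT => t; apply: differentiable_continuous.
  exact/derivable1_diffP/(@ex_derive _ _ _ _ _ _ _ (dE c t)).
have cw2 : {within `[a, b], continuous (w * w)} by move=> x; apply: cvgM; exact: cw.
move: ab; rewrite le_eqVlt => /predU1P[<-|ab].
  by rewrite subrr mulr0 expR0 mulr1.
have key (c : R) : exists2 t, t \in `]a, b[ &
    w b * w b * expR (c * b) - w a * w a * expR (c * a) =
    (2 * w t * dw t + c * (w t * w t)) * expR (c * t) * (b - a).
  have [t tab E] := MVT ab
    (fun t tab => is_deriveM (is_deriveM (ww t tab) (ww t tab)) (dE c t))
    (fun x => cvgM (cw2 x) (cE c x)).
  exists t => //; rewrite [LHS]E; congr (_ * _).
  by rewrite ?mulrfctE /GRing.scale /=; ring.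
have sq (x y : R) : 0 <= y -> x * x <= y * y -> `|x| <= y.
  by move=> y0; rewrite -!expr2 -[x ^+ 2]real_normK ?num_real// ler_pXn2r// nnegrE.
have bd t : t \in `]a, b[ -> `|2 * w t * dw t| <= 2 * L * (w t * w t).
  move=> tab; have -> : w t * w t = `|w t| * `|w t|.
    by rewrite -normrM ger0_norm// -expr2 sqr_ge0.
  rewrite !normrM (ger0_norm (ler0n _ 2)).
  by have := ler_wpM2l (normr_ge0 (w t)) (h t tab); lra.
have mv (X Y p q : R) : X * expR p <= Y * expR q -> X <= Y * expR (q - p).
  by rewrite expRD expRN mulrA ler_pdivlMr ?expR_gt0.
have sqE (x : R) : `|x| * expR (L * (b - a)) * (`|x| * expR (L * (b - a))) =
    x * x * expR (L * (b - a) + L * (b - a)).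
  by rewrite mulrACA -expRD -normrM ger0_norm// -expr2 sqr_ge0.
split; apply: sq; rewrite ?mulr_ge0 ?expR_ge0// sqE.
- rewrite (_ : _ + _ = - (2 * L) * a - - (2 * L) * b); last by ring.
  apply: mv; have [t tab E] := key (- (2 * L)).
  rewrite -subr_le0 E pmulr_lle0 ?subr_gt0// pmulr_lle0 ?expR_gt0//.
  by have := bd t tab; rewrite ler_norml => /andP[]; lra.
- rewrite (_ : _ + _ = 2 * L * b - 2 * L * a); last by ring.
  apply: mv; have [t tab E] := key (2 * L).
  rewrite -subr_ge0 E mulr_ge0 ?subr_ge0 ?(ltW ab)// mulr_ge0 ?expR_ge0//.
  by have := bd t tab; rewrite ler_norml => /andP[]; lra.
Qed.

(** Integrating from -1 keeps 0 in the interior, so that the derivative is two-sided at the initial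
    time as well. *)
Lemma continuous_primitive (g : R -> R) : continuous g ->
  exists2 G : R -> R, G 0 = 0 & forall t : R, -1 < t -> is_derive t 1 G (g t).
Proof.
move=> cg; pose G0 x := (\int[lebesgue_measure]_(t in `[-1%R, x]) g t)%R.
exists (fun x => G0 x - G0 0); first by rewrite subrr.
move=> t t1; have tt : t < t + 1 by rewrite ltrDl.
have ig : lebesgue_measure.-integrable `[-1, t + 1] (EFin \o g).
  apply: continuous_compact_integrable; first exact: segment_compact.
  exact: continuous_subspaceT.
have [dG <-] := continuous_FTC1_closed tt ig t1 (cg t).
rewrite -[X in is_derive _ _ _ X]subr0.
apply: is_deriveB; rewrite derive1E; exact: derivableP.
Qed.

End derivative_comparison.

(** * Picard iteration on [0, T] *)

Section picard.
Context {R : realType}.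

(** The intervals of radius [2 * K * 2 ^- k] around [a k] are nested, so the supremum of their left
    ends lies in all of them. *)
Lemma geometric_limit (a : nat -> R) (K : R) :
  (forall k, `|a k.+1 - a k| <= K * 2 ^- k) ->
  exists l, forall k, `|l - a k| <= 2 * K * 2 ^- k.
Proof.
move=> aK; pose l k := a k - 2 * K * 2 ^- k; pose u k := a k + 2 * K * 2 ^- k.
have half k : (2 : R) ^- k.+1 = 2 ^- k / 2 by rewrite exprS invfM mulrC.
have l_nd : nondecreasing_seq l.
  apply/nondecreasing_seqP => k; rewrite /l half.
  by have := aK k; rewrite ler_norml => /andP[+ _]; lra.
have u_ni : nonincreasing_seq u.
  apply/nonincreasing_seqP => k; rewrite /u half.
  by have := aK k; rewrite ler_norml => /andP[_ +]; lra.
have lu j k : l j <= u k.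
  rewrite (le_trans (l_nd _ _ (leq_maxl j k)))//.
  rewrite (le_trans _ (u_ni _ _ (leq_maxr j k)))// /l /u.
  have : 0 <= K * 2 ^- maxn j k by rewrite (le_trans _ (aK _)).
  by lra.
have ubl k : ubound (range l) (u k) by move=> _ [j _ <-].
have sl : has_sup (range l) by split; [exists (l 0), 0|exists (u 0)].
exists (sup (range l)) => k; rewrite ler_norml; apply/andP; split.
  have : l k <= sup (range l) by apply: ub_le_sup; [case: sl|exists k].
  by rewrite /l; lra.
have : sup (range l) <= u k by apply: ge_sup; [case: sl|exact: ubl].
by rewrite /u; lra.
Qed.

Lemma le_geometric_eq0 (x M : R) : (forall k, `|x| <= M * 2 ^- k) -> x = 0.
Proof.
move=> xM; apply/eqP; rewrite -normr_eq0 eq_le normr_ge0 andbT leNgt.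
apply/negP => x0; pose k := Num.truncn (M / `|x|).
have : M / `|x| < 2 ^+ k.
  rewrite (lt_le_trans (truncnS_gt _))// -natrX ler_nat; exact: ltn_expl.
rewrite ltr_pdivrMr// => h; have := xM k.
by rewrite ler_pdivlMr ?exprn_gt0// mulrC leNgt h.
Qed.

Variables (f : R -> R -> R) (L T : R).
Hypotheses (L0 : 0 <= L) (T0 : 0 <= T).
Hypothesis f_lip : forall s x y, `|f s x - f s y| <= L * `|x - y|.
Hypothesis f_bd : forall s x, `|f s x| <= L.
Hypothesis f_cont : forall x, continuous (f ^~ x).

(** Composition with this 1-Lipschitz retraction onto [0, T] extends curves and fields controlled
    only there to the whole line; derivatives at 0 and [T] can then be two-sided. *)
Definition clamp (s : R) : R := Num.max 0 (Num.min s T).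

Lemma clamp_itv s : 0 <= clamp s <= T.
Proof. by rewrite /clamp le_max lexx ge_max T0 ge_min lexx orbT. Qed.

Lemma clamp_id s : 0 <= s <= T -> clamp s = s.
Proof.
by move=> /andP[s0 sT]; rewrite /clamp (min_idPl sT); apply/max_idPr.
Qed.

Lemma clamp_lip s t : `|clamp s - clamp t| <= `|s - t|.
Proof.
have TT := T0; have h1 := ler_norm (s - t); have h2 := ler_norm (t - s).
rewrite distrC in h2; rewrite /clamp !minEle !maxEle ler_norml.
case: (leP s T) => ?; case: (leP t T) => ?; case: (leP 0 s) => ?;
  case: (leP 0 t) => ?; rewrite ?T0; apply/andP; split; lra.
Qed.

Lemma clamp_nd : {homo clamp : s t / s <= t}.
Proof.
move=> s t st; have TT := T0; rewrite /clamp !minEle !maxEle.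
case: (leP s T) => ?; case: (leP t T) => ?; case: (leP 0 s) => ?;
  case: (leP 0 t) => ?; rewrite ?T0; lra.
Qed.

Lemma lip_continuous (p : R -> R) (K : R) :
  (forall s t, `|p s - p t| <= K * `|s - t|) -> continuous p.
Proof.
move=> pK t; apply/cvgrPdist_le => e e0.
near=> s; rewrite (le_trans (pK _ _))//.
rewrite (@le_trans _ _ ((`|K| + 1) * `|t - s|))//.
  by rewrite ler_wpM2r// (le_trans (ler_norm K))// lerDl.
rewrite -ler_pdivlMl ?ltr_wpDl// mulrC.
near: s; apply: cvgr_dist_le; first exact: cvg_id.
by rewrite divr_gt0// ltr_wpDl.
Unshelve. all: by end_near. Qed.

Lemma field_continuous (p : R -> R) : continuous p ->
  continuous (fun s => f s (p s)).
Proof.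
move=> cp t.
rewrite /continuous_at -[X in _ --> X]addr0.
rewrite (_ : (fun s => _) = (fun s => f s (p t) + (f s (p s) - f s (p t)))).
  apply: cvgD; first exact: f_cont.
  apply/norm_cvg0P.
  apply: (@squeeze_cvgr _ _ _ _ (fun=> 0) (fun s => L * `|p s - p t|)).
  - by apply: nearW => s; rewrite normr_ge0 f_lip.
  - exact: cvg_cst.
  - rewrite -[X in _ --> X](mulr0 L); apply: (@cvgM _ _ _ _ (fun=> L)).
      exact: cvg_cst.
    have : `|p s - p t| @[s --> t] --> `|p t - p t|.
      by apply: cvg_norm; apply: cvgB; [exact: cp|exact: cvg_cst].
    by rewrite subrr normr0.
by apply/funext => s; rewrite addrCA subrr addr0.
Qed.

Variable x0 : R.

Let primitive (g : R -> R) : R -> R := get [set G : R -> R |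
  G 0 = 0 /\ forall t : R, -1 < t -> is_derive t 1 G (g t)].

Let step (p : R -> R) (t : R) : R := x0 + primitive (fun s => f s (p (clamp s))) t.

Let step0 p : continuous (p \o clamp) -> step p 0 = x0.
Proof.
move=> /field_continuous/continuous_primitive[G G0 GD].
by rewrite /step /primitive; case: xgetP => [y _ [-> _]|/(_ G)[//]]; rewrite addr0.
Qed.

Let stepD p t : continuous (p \o clamp) -> 0 <= t <= T ->
  is_derive t 1 (step p) (f t (p t)).
Proof.
move=> /field_continuous/continuous_primitive[G G0 GD] tT.
have t1 : -1 < t by case/andP: tT => h _; rewrite (lt_le_trans _ h)// ltrN10.
have -> : f t (p t) = f t (p (clamp t)) by rewrite clamp_id.
rewrite /step /primitive; case: xgetP => [y _ [_ /(_ _ t1) h]|/(_ G)[//]].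
by have := is_deriveD (is_derive_cst x0 t 1) h; rewrite add0r.
Qed.

Let within_derive (p : R -> R) (dp : R -> R) a b : 0 <= a -> b <= T ->
  (forall t, 0 <= t <= T -> is_derive t 1 p (dp t)) ->
  {within `[a, b], continuous p}.
Proof.
move=> a0 bT pd; apply: derivable_within_continuous => t.
rewrite in_itv/= => /andP[at_ tb]; apply: ex_derive; apply: pd.
by rewrite (le_trans a0)// (le_trans tb).
Qed.

Let step_lip p s t : continuous (p \o clamp) ->
  `|step p (clamp s) - step p (clamp t)| <= L * `|s - t|.
Proof.
move=> cp; wlog st : s t / s <= t.
  by move=> h; case: (leP s t) => [/h//|/ltW/h]; rewrite distrC [`|t - _|]distrC.
have cst : clamp s <= clamp t by exact: clamp_nd.
have /andP[s0 sT] := clamp_itv s; have /andP[t0 tT] := clamp_itv t.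
have sub u : u \in `](clamp s), (clamp t)[ -> 0 <= u <= T.
  by rewrite in_itv/= => /andP[su ut]; rewrite (le_trans s0 (ltW su)) (le_trans (ltW ut)).
rewrite distrC.
apply: (@le_trans _ _ (L * clamp t - L * clamp s)).
  apply: (@dist_le_primitive _ _ (fun u => f u (p u)) (fun u => L * u) (fun=> L)) => //.
  - by apply: within_derive => // u; exact: stepD.
  - apply: continuous_subspaceT => u; apply: cvgM; [exact: cvg_cst|exact: cvg_id].
  - by move=> u /sub; exact: stepD.
  - by move=> u _; apply: is_derive_eq; rewrite /GRing.scale/= mulr1.
rewrite -mulrBr ler_wpM2l// -[leLHS]ger0_norm ?subr_ge0// distrC.
exact: clamp_lip.
Qed.

Let pk k : R -> R := iter k step (fun=> x0).

Let pk_cont k : continuous (pk k \o clamp).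
Proof.
elim: k => [|k ih]; first by move=> t; exact: cvg_cst.
by apply: (@lip_continuous _ L) => s t; exact: step_lip.
Qed.

Let exp_derive (c d t : R) : is_derive t 1 (fun s => d * expR (c * s)) (d * c * expR (c * t)).
Proof.
have hg : is_derive t 1 (fun s : R => c * s) c.
  by apply: is_derive_eq; rewrite /GRing.scale /= mulr1.
by apply: is_derive_eq; rewrite /GRing.scale/=; ring.
Qed.

(** The weight [expR (2 * L * t)] makes the Picard map contract by 1/2 on the whole of [0, T],
    whatever its length, so no gluing of short intervals is needed. *)
Let pk_step k t : 0 <= t <= T ->
  `|pk k.+1 t - pk k t| <= L * T * 2 ^- k * expR (2 * L * t).
Proof.
elim: k t => [|k ih] t tT; have /andP[t0 tT'] := tT.
- rewrite expr0 invr1 mulr1 /=.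
  have := step_lip t 0 (@pk_cont 0); rewrite !clamp_id ?lexx// step0; last exact: (@pk_cont 0).
  move/le_trans; apply; rewrite subr0 ger0_norm//.
  rewrite -[leLHS]mulr1 ler_pM ?mulr_ge0//; first by rewrite ler_wpM2l.
  by rewrite -expR0 ler_expR !mulr_ge0.
- have ck j : continuous (pk j \o clamp) by exact: pk_cont.
  have sub u : u \in `]0, t[ -> 0 <= u <= T.
    by rewrite in_itv/= => /andP[/ltW -> /ltW ut]; rewrite (le_trans ut).
  have E0 : pk k.+2 0 - pk k.+1 0 = 0.
    by rewrite [pk k.+2]/= [pk k.+1]/= (step0 (ck k.+1)) (step0 (ck k)) subrr.
  have D u : 0 <= u <= T -> is_derive u 1 (pk k.+2 \- pk k.+1)
      (f u (pk k.+1 u) - f u (pk k u)).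
    by move=> uT; apply: is_deriveB; [exact: (stepD (ck k.+1) uT)|exact: (stepD (ck k) uT)].
  have := @dist_le_primitive _ (pk k.+2 \- pk k.+1)
     (fun u => f u (pk k.+1 u) - f u (pk k u))
     (fun u => L * T * 2 ^- k.+1 * expR (2 * L * u))
     (fun u => L * T * 2 ^- k.+1 * (2 * L) * expR (2 * L * u)) 0 t t0.
  rewrite [(_ \- _) 0]/= E0 subr0 => /(_ _ _ _ _ _)/le_trans; apply.
  + exact: within_derive D.
  + apply: derivable_within_continuous => u _; apply: ex_derive.
  + by move=> u /sub; exact: D.
  + by move=> u _; exact: exp_derive.
  + move=> u /sub uT; rewrite (le_trans (f_lip _ _ _))//.
    rewrite (le_trans (ler_wpM2l L0 (ih u uT)))// exprS invfM.
    by rewrite le_eqVlt; apply/orP; left; apply/eqP; field; rewrite ?expf_neq0.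
  + by rewrite lerBlDr lerDl !mulr_ge0 ?invr_ge0 ?exprn_ge0 ?expR_ge0.
Qed.

Lemma picard : exists2 p : R -> R, p 0 = x0 &
  forall t, 0 <= t <= T -> is_derive t 1 p (f t (p t)).
Proof.
pose K := L * T * expR (2 * L * T).
have pkK k t : 0 <= t <= T -> `|pk k.+1 t - pk k t| <= K * 2 ^- k.
  move=> tT; rewrite (le_trans (pk_step k tT))// /K [leLHS]mulrAC.
  have e0 : 0 <= 2 ^- k :> R by rewrite invr_ge0 exprn_ge0.
  apply: (ler_wpM2r e0); rewrite ler_wpM2l ?mulr_ge0// ler_expR.
  by rewrite ler_wpM2l ?mulr_ge0//; case/andP: tT.
have /choice[q0 q0P] : forall t, exists l, 0 <= t <= T ->
    forall k, `|l - pk k t| <= 2 * K * 2 ^- k.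
  move=> t; have [tT|_] := boolP (0 <= t <= T); last by exists 0.
  have [l lP] := geometric_limit (fun k => pkK k t tT); by exists l.
have L00 k s : 0 <= s <= T -> `|pk k s - q0 s| <= 2 * K * 2 ^- k.
  by move=> sT; rewrite distrC q0P.
have q0_lip s t : `|q0 (clamp s) - q0 (clamp t)| <= L * `|s - t|.
  apply/ler_addgt0Pr => e e0.
  pose k := Num.truncn (4 * K / e).
  have ke : 4 * K * 2 ^- k <= e.
    rewrite ler_pdivrMr ?exprn_gt0// [e * _]mulrC -ler_pdivrMr//.
    rewrite (le_trans (ltW (truncnS_gt _)))// -natrX ler_nat; exact: ltn_expl.
  have h1 := L00 k.+1 _ (clamp_itv s); have h2 := L00 k.+1 _ (clamp_itv t).
  have h3 : `|pk k.+1 (clamp s) - pk k.+1 (clamp t)| <= L * `|s - t|.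
    exact: (step_lip s t (@pk_cont k)).
  have h4 : 4 * K * 2 ^- k.+1 <= 4 * K * 2 ^- k.
    have K0 : 0 <= K by rewrite !mulr_ge0 ?expR_ge0.
    by rewrite ler_wpM2l ?mulr_ge0// lef_pV2 ?posrE ?exprn_gt0// ler_eXn2l ?ltr1n.
  move: h1 h2 h3; rewrite !ler_norml => /andP[a1 a2] /andP[b1 b2] /andP[c1 c2].
  by apply/andP; split; lra.
have cq0 : continuous (q0 \o clamp) by exact: lip_continuous q0_lip.
have D t : 0 <= t <= T -> is_derive t 1 (step q0) (f t (q0 t)) by exact: stepD.
(* The witness is [step q0] and not [q0]: the limit is determined only on [0, T], while [step q0] is
   differentiable from both sides at every point of it. *)
exists (step q0); first exact: step0.
move=> t tT; suff -> : step q0 t = q0 t by exact: D.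
have /andP[t0 tT'] := tT.
apply/eqP; rewrite -subr_eq0; apply/eqP.
(* Both functions are compared with [pk k.+1], which is [step (pk k)]: the first term bounds its
   distance to [step q0], the second its distance to [q0]. *)
apply: (@le_geometric_eq0 _ (L * (2 * K) * T + 2 * K)) => k.
have sub u : u \in `]0, t[ -> 0 <= u <= T.
  by rewrite in_itv/= => /andP[/ltW -> /ltW ut]; rewrite (le_trans ut).
have Dk u : 0 <= u <= T -> is_derive u 1 (pk k.+1 \- step q0) (f u (pk k u) - f u (q0 u)).
  by move=> uT; apply: is_deriveB; [exact: (stepD (@pk_cont k) uT)|exact: D].
have := @dist_le_primitive _ (pk k.+1 \- step q0)
     (fun u => f u (pk k u) - f u (q0 u))
     (fun u => L * (2 * K * 2 ^- k) * u) (fun=> L * (2 * K * 2 ^- k)) 0 t t0.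
have -> : (pk k.+1 \- step q0) 0 = 0.
  by rewrite [LHS]/= (step0 (@pk_cont k)) (step0 cq0) subrr.
rewrite subr0 mulr0 subr0.
have h1 := L00 k.+1 _ tT.
move=> /(_ _ _ _ _ _) h2.
have {}h2 : `|pk k.+1 t - step q0 t| <= L * (2 * K * 2 ^- k) * t.
  apply: h2.
  - exact: within_derive Dk.
  - by apply: continuous_subspaceT => u; apply: cvgM; [exact: cvg_cst|exact: cvg_id].
  - by move=> u /sub; exact: Dk.
  - by move=> u _; apply: is_derive_eq; rewrite /GRing.scale/= mulr1.
  - by move=> u /sub uT; rewrite (le_trans (f_lip _ _ _))// ler_wpM2l// L00.
have K0 : 0 <= K by rewrite !mulr_ge0 ?expR_ge0.
have h3 : L * (2 * K * 2 ^- k) * t <= L * (2 * K * 2 ^- k) * T.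
  by rewrite ler_wpM2l// !mulr_ge0// invr_ge0 exprn_ge0.
have h4 : 2 * K * 2 ^- k.+1 <= 2 * K * 2 ^- k.
  by rewrite ler_wpM2l ?mulr_ge0// lef_pV2 ?posrE ?exprn_gt0// ler_eXn2l ?ltr1n.
move: h1 h2; rewrite !ler_norml => /andP[a1 a2] /andP[b1 b2].
by apply/andP; split; lra.
Qed.

End picard.

(** * The flow of a Lipschitz field on the circle *)

Section circle_flow.
Context {R : realType}.
Variables (V : R -> circle R -> R) (L T : R).
Hypotheses (L0 : 0 <= L) (T0 : 0 <= T).
Hypothesis V_lip : forall t u w, 0 <= t <= T -> `|V t u - V t w| <= L * mdist u w.
Hypothesis V_bd : forall t u, 0 <= t <= T -> `|V t u| <= L.
Hypothesis V_cont : forall u, continuous (fun t => V (clamp T t) u).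

Let oo_cc a b t : 0 <= a -> b <= T -> t \in `]a, b[ -> 0 <= t <= T.
Proof.
move=> a0 bT; rewrite in_itv/= => /andP[at_ tb].
by rewrite (le_trans a0 (ltW at_)) (le_trans (ltW tb)).
Qed.

Let trajectory_continuous p a b : trajectory T V p -> 0 <= a -> b <= T ->
  {within `[a, b], continuous p}.
Proof.
move=> [cp _] a0 bT; apply: continuous_subspaceW cp => t /=.
by rewrite !in_itv/= => /andP[at_ tb]; rewrite (le_trans a0) //= (le_trans tb).
Qed.

Let trajectory_derive p a b t : trajectory T V p -> 0 <= a -> b <= T ->
  t \in `]a, b[ -> is_derive t 1 p (V t (toCircle (p t))).
Proof.
move=> [_ dp] a0 bT tab; apply: dp; move: tab; rewrite !in_itv/= => /andP[at_ tb].
by rewrite (le_lt_trans a0 at_) (lt_le_trans tb).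
Qed.

Let trajectory_gap p q a b : trajectory T V p -> trajectory T V q ->
  0 <= a -> a <= b -> b <= T ->
  `|p b - q b| <= `|p a - q a| * expR (L * (b - a)) /\
  `|p a - q a| <= `|p b - q b| * expR (L * (b - a)).
Proof.
move=> tp tq a0 ab bT.
have cw : {within `[a, b], continuous (p \- q)}.
  by move=> x; apply: cvgB; exact: trajectory_continuous.
apply: (gronwall_le L0 ab cw
  (fun t h => is_deriveB (trajectory_derive tp a0 bT h) (trajectory_derive tq a0 bT h))).
move=> t /(oo_cc a0 bT) tT; rewrite (le_trans (V_lip _ _ tT))//.
by rewrite ler_wpM2l// mdist_toCircle.
Qed.

Let trajectory_shift p (c : R) (k : int) : c = 2 * pi * k%:~R ->
  trajectory T V p -> trajectory T V (fun t => p t + c).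
Proof.
move=> cE [cp dp]; split; first by move=> x; apply: cvgD; [exact: cp|exact: cvg_cst].
move=> t tT; have <- : toCircle (p t) = toCircle (p t + c).
  by apply: (@toCircle_eq _ _ _ k); rewrite cE.
by have := is_deriveD (dp t tT) (is_derive_cst c t 1); rewrite addr0.
Qed.

(** Lifts of one state differ by a multiple of [2 * pi], and a trajectory translated by it is again
    a trajectory. The two bounds of [gronwall_le] then propagate a zero gap forward and backward in
    time. *)
Let trajectory_unique p q s t : trajectory T V p -> trajectory T V q ->
  0 <= s <= T -> 0 <= t <= T ->
  toCircle (p t) = toCircle (q t) -> toCircle (p s) = toCircle (q s).
Proof.
move=> tp tq /andP[s0 sT] /andP[t0 tT] /toCircle_inj[k E].
apply/esym/(@toCircle_eq _ _ _ (- k)); rewrite intrN mulrN.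
suff : p s + 2 * pi * k%:~R - q s = 0 by lra.
have tp' := trajectory_shift (erefl (2 * pi * k%:~R)) tp.
have Et : p t + 2 * pi * k%:~R - q t = 0 by rewrite E subrr.
apply/eqP; rewrite -normr_eq0 eq_le normr_ge0 andbT.
have [st|/ltW ts] := leP s t.
  have [_] := trajectory_gap tp' tq s0 st tT.
  by rewrite Et normr0 mul0r.
have [+ _] := trajectory_gap tp' tq t0 ts sT.
by rewrite Et normr0 mul0r.
Qed.

(* For fixed [t] the map [P ^~ t] is onto by the intermediate value theorem, so
   trajectories started at time 0 reach every state at time [t]: direct images
   under the backward flow are preimages under [P]. *)
Lemma flow_lift : exists P : R -> R -> R,
  [/\ forall x, P x 0 = x,
      forall x t, 0 <= t <= T -> is_derive t 1 (P x) (V t (toCircle (P x t))),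
      forall x y t, 0 <= t <= T -> `|P x t - P y t| <= `|x - y| * expR (L * t),
      (forall x y t, 0 <= t <= T -> toCircle x = toCircle y ->
        toCircle (P x t) = toCircle (P y t)) &
      forall t S, 0 <= t <= T ->
        flow T V 0 t @` S = [set u | S (toCircle (P (angle u) t))]].
Proof.
pose f s x := V (clamp T s) (toCircle x).
have f_lip s x y : `|f s x - f s y| <= L * `|x - y|.
  rewrite (le_trans (V_lip _ _ (clamp_itv T0 s)))//.
  by rewrite ler_wpM2l// mdist_toCircle.
have f_bd s x : `|f s x| <= L by apply: V_bd; exact: clamp_itv.
have f_cont x : continuous (f ^~ x) by exact: V_cont.
have /choice[P PP] x : exists p : R -> R, p 0 = x /\
    forall t, 0 <= t <= T -> is_derive t 1 p (f t (p t)).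
  by have [p p0 pd] := picard L0 T0 f_lip f_bd f_cont x; exists p.
have P0 x : P x 0 = x by case: (PP x).
have Pd x t : 0 <= t <= T -> is_derive t 1 (P x) (V t (toCircle (P x t))).
  by move=> tT; have [_ /(_ t tT)] := PP x; rewrite /f clamp_id.
have Ptraj x : trajectory T V (P x).
  split.
    apply: derivable_within_continuous => t; rewrite in_itv/= => tT.
    exact: (@ex_derive _ _ _ _ _ _ _ (Pd x t tT)).
  by move=> t /(oo_cc (lexx 0) (lexx T)) tT; exact: Pd.
have T00 : 0 <= (0 : R) <= T by rewrite lexx.
have Plip x y t : 0 <= t <= T -> `|P x t - P y t| <= `|x - y| * expR (L * t).
  move=> /andP[t0 tT].
  by have [+ _] := trajectory_gap (Ptraj x) (Ptraj y) (lexx 0) t0 tT; rewrite !P0 subr0.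
have Pper x y t : 0 <= t <= T -> toCircle x = toCircle y ->
    toCircle (P x t) = toCircle (P y t).
  move=> tT xy; apply: (trajectory_unique (Ptraj x) (Ptraj y) tT T00).
  by rewrite !P0.
(* [flow] selects some trajectory through the given state; uniqueness makes the selection
   irrelevant, and [P x] shows that there is one. *)
have Pback x t : 0 <= t <= T -> flow T V 0 t (toCircle (P x t)) = toCircle x.
  move=> tT; rewrite /flow; case: xgetP => [y _ [p [tp pt <-]]|].
    by rewrite (trajectory_unique tp (Ptraj x) T00 tT pt) P0.
  by move=> /(_ (toCircle x)) []; exists (P x); split => //; rewrite P0.
have Pbd x t : 0 <= t <= T -> `|P x t - x| <= L * T.
  move=> /andP[t0 tT]; rewrite -{2}(P0 x) (@le_trans _ _ (L * t - L * 0))//; last first.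
    by rewrite mulr0 subr0 ler_wpM2l.
  apply: (@dist_le_primitive _ _ (fun t => V t (toCircle (P x t)))
      (fun t => L * t) (fun=> L)) => //.
  - exact: trajectory_continuous.
  - by apply: continuous_subspaceT => u; apply: cvgM; [exact: cvg_cst|exact: cvg_id].
  - by move=> u; exact: trajectory_derive.
  - by move=> u _; apply: is_derive_eq; rewrite /GRing.scale/= mulr1.
  - by move=> u /(oo_cc (lexx 0) tT); exact: V_bd.
have Psurj z t : 0 <= t <= T -> exists x, P x t = z.
  move=> tT; have LT0 : 0 <= L * T by rewrite mulr_ge0.
  (* No trajectory moves by more than [L * T] (see [Pbd]), so those started at these two points end
     on opposite sides of [z], or at [z]. *)
  have ab : z - L * T <= z + L * T by lra.
  have [||x _ xz] := @IVT _ (P ^~ t) _ _ z ab.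
  - apply: continuous_subspaceT; apply: (@lip_continuous _ _ (expR (L * t))).
    by move=> x y; rewrite mulrC Plip.
  - have h1 := Pbd (z - L * T) t tT; have h2 := Pbd (z + L * T) t tT.
    move: h1 h2; rewrite !ler_norml => /andP[_ h1] /andP[h2 _].
    by rewrite ge_min le_max; apply/andP; split; apply/orP; [left|right]; lra.
  - by exists x.
exists P; split => // t S tT; apply/seteqP; split => [u [z Sz <-]|u Su] /=.
  have [x xz] := Psurj (angle z) t tT.
  have zE : z = toCircle (P x t) by rewrite xz toCircleK.
  by rewrite zE Pback// (Pper _ x) -?zE// toCircleK.
by exists (toCircle (P (angle u) t)) => //; rewrite Pback// toCircleK.
Qed.

End circle_flow.

(** * Weak convergence on metric spaces *)

Section lipschitz_envelope.
Context {R : realType} {T : metricType R}.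
Variables (g : T -> R) (M : R).
Hypothesis gM : forall x, `|g x| <= M.

(** The Pasch-Hausdorff envelope, the largest [k]-Lipschitz minorant of [g]. It supplies continuous
    test functions below a discontinuous [g]. *)
Definition envelope (k : nat) (y : T) : R :=
  inf (range (fun z => g z + k%:R * mdist y z)).

Let lb k y z : - M <= g z + k%:R * mdist y z.
Proof.
have := gM z; rewrite ler_norml => /andP[+ _] => /le_trans; apply.
by rewrite lerDl mulr_ge0// mdist_ge0.
Qed.

Let hi k y : has_inf (range (fun z => g z + k%:R * mdist y z)).
Proof.
by split; [exists (g y + k%:R * mdist y y), y|exists (- M) => _ [z _ <-]; exact: lb].
Qed.

Let envelope_lb k y z : envelope k y <= g z + k%:R * mdist y z.
Proof. by apply: ge_inf; [exact: (hi k y).2|exists z]. Qed.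

Let le_envelope k y c : (forall z, c <= g z + k%:R * mdist y z) -> c <= envelope k y.
Proof. by move=> h; apply: lb_le_inf; [exact: (hi k y).1|move=> _ [z _ <-]]. Qed.

Lemma envelope_le k y : envelope k y <= g y.
Proof. by have := envelope_lb k y y; rewrite mdistxx mulr0 addr0. Qed.

Lemma envelope_ge k y c : (forall x, c <= g x) -> c <= envelope k y.
Proof.
move=> h; apply: le_envelope => z; rewrite (le_trans (h z))// lerDl.
by rewrite mulr_ge0// mdist_ge0.
Qed.

Lemma envelope_norm k y : `|envelope k y| <= M.
Proof.
rewrite ler_norml envelope_ge => [|x]; last first.
  by have := gM x; rewrite ler_norml => /andP[].
by rewrite (le_trans (envelope_le _ _))// (le_trans (ler_norm _)).
Qed.

Lemma envelope_lip k x y : `|envelope k x - envelope k y| <= k%:R * mdist x y.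
Proof.
wlog h : x y / envelope k y <= envelope k x.
  move=> h; have [/h//|/ltW/h] := leP (envelope k y) (envelope k x).
  by rewrite distrC metric_sym.
rewrite ger0_norm ?subr_ge0// lerBlDr -lerBlDl; apply: le_envelope => z.
rewrite lerBlDl (le_trans (envelope_lb k x z))// addrCA lerD2l -mulrDr.
by rewrite ler_wpM2l// metric_triangle.
Qed.

Lemma envelope_cvg y : {for y, continuous g} -> envelope n y @[n --> \oo] --> g y.
Proof.
move=> cg; apply/cvgrPdist_le => e e0.
have /cvgrPdist_le/(_ e e0) := cg.
move/nbhs_ballP => [/= r r0 hr].
(* Beyond [K] the penalty [n%:R * mdist y z] is at least [2 * M], the largest possible oscillation
   of [g], as soon as [z] is at distance [r] or more; only nearby [z] remain. *)
pose K := Num.truncn (2 * M / r).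
near=> n; have nK : (K.+1 <= n)%N by near: n; exact: nbhs_infty_ge.
rewrite ger0_norm ?subr_ge0 ?envelope_le// lerBlDr -lerBlDl.
apply: le_envelope => z; have [yz|yz] := ltP (mdist y z) r.
  have : `|g y - g z| <= e by apply: hr; rewrite ballEmdist.
  have h : 0 <= n%:R * mdist y z by rewrite mulr_ge0// mdist_ge0.
  by rewrite ler_norml => /andP[_ +]; lra.
have h1 : 2 * M <= n%:R * mdist y z.
  rewrite (@le_trans _ _ (n%:R * r))// ?ler_wpM2l// -ler_pdivrMr//.
  by rewrite (le_trans (ltW (truncnS_gt _)))// ler_nat.
have := gM y; have := gM z; rewrite !ler_norml => /andP[h2 _] /andP[_ h3].
by lra.
Unshelve. all: by end_near. Qed.

End lipschitz_envelope.

(** * Borel measurability and the portmanteau theorem *)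

Section borel.
Context {R : realType}.

Lemma lipschitz_continuous {T : metricType R} (f : T -> R) (K : R) :
  (forall x y, `|f x - f y| <= K * mdist x y) -> continuous f.
Proof.
move=> fK x; apply/cvgrPdist_le => e e0.
apply/nbhs_ballP; have K0 : 0 < `|K| + 1 by rewrite ltr_wpDl.
exists (e / (`|K| + 1)); first by rewrite /= divr_gt0.
move=> y; rewrite ballEmdist /= ltr_pdivlMr// => /ltW h.
rewrite (le_trans (fK x y))// (le_trans _ h)// mulrC ler_wpM2l ?mdist_ge0//.
by rewrite (le_trans (ler_norm K))// lerDl.
Qed.

Lemma indic_continuous {T : metricType R} (U : set T) (u : T) :
  open U -> U u -> {for u, continuous (\1_U : T -> R)}.
Proof.
move=> oU Uu; apply/cvgrPdist_le => e e0.
have /nbhs_ballP[r r0 hr] := open_nbhs_nbhs (conj oU Uu).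
apply/nbhs_ballP; exists r => // v /hr Uv /=.
by rewrite !indicE !mem_set// subrr normr0 ltW.
Qed.

Lemma open_preimage_measurable {d} {T : measurableType d} (f : T -> R) :
  (forall U : set R, open U -> measurable (f @^-1` U)) -> measurable_fun setT f.
Proof.
move=> h; apply: (measurability _ (RGenOpens.measurableE R)) => _ [_ [a [b ->] <-]].
by rewrite setTI; apply: h; exact: interval_open.
Qed.

Lemma circle_open_measurable (U : set (circle R)) : open U -> measurable U.
Proof. by move=> oU; exact: sub_sigma_algebra. Qed.

Lemma circle_lip_measurable (f : circle R -> R) (K : R) :
  (forall x y, `|f x - f y| <= K * mdist x y) -> measurable_fun setT f.
Proof.
move=> fK; apply: open_preimage_measurable => U oU; apply: circle_open_measurable.
by apply: open_comp => // x _; exact: (lipschitz_continuous fK).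
Qed.

Context {d} {Omega : borelMetricType d R}.

Lemma borel_open_measurable (U : set Omega) : open U -> measurable U.
Proof. by move=> oU; rewrite measurable_borelE; exact: sub_sigma_algebra. Qed.

Lemma borel_lip_measurable (f : Omega -> R) (K : R) :
  (forall x y, `|f x - f y| <= K * mdist x y) -> measurable_fun setT f.
Proof.
move=> fK; apply: open_preimage_measurable => U oU; apply: borel_open_measurable.
by apply: open_comp => // x _; exact: (lipschitz_continuous fK).
Qed.

(** The continuity points of an arbitrary function form a G-delta set: [O n] asks for oscillation at
    most [n.+1%:R^-1] on some ball, and is open by halving the radius. *)
Lemma measurable_discontinuities (g : Omega -> R) :
  measurable [set x | ~ {for x, continuous g}].
Proof.
pose O n := [set x : Omega | exists2 r : R, 0 < r & forall y z, mdist x y < r ->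
  mdist x z < r -> `|g y - g z| <= n.+1%:R^-1].
have -> : [set x | ~ {for x, continuous g}] = ~` \bigcap_n O n.
  rewrite -[LHS]setCK; congr (~` _); apply/seteqP; split => x /=.
    move=> /contrapT cg n _; have /cvgrPdist_lt := cg.
    have n0 : 0 < n.+1%:R^-1 / 2 :> R by rewrite divr_gt0.
    move=> /(_ _ n0) /nbhs_ballP[/= r r0 hr].
    exists r => // y z xy xz.
    move: (n.+1%:R^-1) n0 hr => c c0 hr.
    have /hr/= : ball x r y by rewrite ballEmdist.
    have /hr/= : ball x r z by rewrite ballEmdist.
    rewrite !ltr_norml ler_norml => /andP[a1 a2] /andP[b1 b2].
    by apply/andP; split; lra.
  move=> h; apply; apply/cvgrPdist_le => e e0; apply/nbhs_ballP.
  have [r r0 hr] := h (Num.truncn e^-1) I.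
  exists r => // y; rewrite ballEmdist /= => xy.
  rewrite (le_trans (hr x y _ xy)) ?mdistxx//.
  by rewrite invf_ple ?posrE// ltW// truncnS_gt.
apply: measurableC; apply: bigcapT_measurable => n; apply: borel_open_measurable.
rewrite openE => x [r r0 hr]; apply/nbhs_ballP.
exists (r / 2); first by rewrite /= divr_gt0.
move=> x'; rewrite ballEmdist /= => xx'; exists (r / 2); first by rewrite divr_gt0.
move=> y z x'y x'z; apply: hr; rewrite (le_lt_trans (metric_triangle x x' _))//;
  by rewrite [ltRHS]splitr ltrD.
Qed.

(** Lipschitz envelopes are continuous minorants whose [nu]-integrals converge to that of [g], which
    bounds the integrals against [nu_ n] from below; the same bound for [- g] gives the other
    side. *)
Lemma weak_cvg_ae_continuous (nu_ : nat -> {measure set Omega -> \bar R})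
    (nu : {measure set Omega -> \bar R}) (g : Omega -> R) :
  (forall n, nu_ n setT < +oo)%E -> (nu setT < +oo)%E ->
  weak_cvg nu_ nu -> bmfun g -> {ae nu, forall x, {for x, continuous g}} ->
  \int[nu_ n]_x g x @[n --> \oo] --> \int[nu]_x g x.
Proof.
move=> fnu_ fnu nunu.
have half (f : Omega -> R) (e : R) : bmfun f -> {ae nu, forall x, {for x, continuous f}} ->
    0 < e -> \forall n \near \oo, \int[nu]_x f x - e <= \int[nu_ n]_x f x.
  move=> bf cf e0; have [mf [M fM]] := bf.
  have benv k : bmfun (envelope f k).
    split; first exact: (borel_lip_measurable (envelope_lip fM k)).
    by exists M; exact: envelope_norm.
  have envcvg : \int[nu]_x envelope f k x @[k --> \oo] --> \int[nu]_x f x.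
    apply: (@Rintegral_bounded_cvg _ _ _ _ _ _ M) => //.
    - by move=> k; case: (benv k).
    - by move=> k x; exact: envelope_norm.
    - by apply: filterS cf => x; exact: envelope_cvg.
  have e2 : 0 < e / 2 by rewrite divr_gt0.
  have /cvgrPdist_le/(_ _ e2)[k _ hk] := envcvg.
  have := hk k (leqnn k); rewrite ler_norml => /andP[_ {}hk].
  have : \int[nu_ n]_x envelope f k x @[n --> \oo] --> \int[nu]_x envelope f k x.
    have := nunu (envelope f k) (lipschitz_continuous (envelope_lip fM k)).
    rewrite -EFin_Rintegral// => /(_ _)/fine_cvg; apply.
    exists M; split; first exact: num_real.
    by move=> N /ltW MN x _ /=; rewrite (le_trans (envelope_norm fM _ _)).
  move=> /cvgrPdist_le/(_ _ e2); apply: filterS => n.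
  rewrite ler_norml => /andP[_ h].
  have : \int[nu_ n]_x envelope f k x <= \int[nu_ n]_x f x.
    by apply: bm_le_Rintegral => // x; exact: envelope_le fM _ _.
  by lra.
move=> bg cg; apply/cvgrPdist_le => e e0.
have h1 := half g e bg cg e0.
have h2 : \forall n \near \oo, \int[nu]_x (- g x) - e <= \int[nu_ n]_x (- g x).
  by apply: half => //; [exact: bmfunN|apply: filterS cg => x cx; exact: cvgN].
near=> n.
have a1 : \int[nu]_x g x - e <= \int[nu_ n]_x g x by near: n.
have a2 : \int[nu]_x (- g x) - e <= \int[nu_ n]_x (- g x) by near: n.
move: a2; rewrite !bm_RintegralN// => a2.
by rewrite ler_norml; apply/andP; split; lra.
Unshelve. all: by end_near. Qed.

End borel.

(** * Measure-valued maps and graphops *)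

Section measure_valued_maps.
Context {R : realType}.
Local Notation circle := (circle R).
Implicit Types (mu nu : finmeas R) (phi : circle -> R).

Lemma finmeas_lty mu : (mu setT < +oo)%E.
Proof. by rewrite ltey_eq fin_num_measure. Qed.

Lemma BL1_bmfun phi : BL1 phi -> bmfun phi.
Proof.
move=> [p01 plip]; split.
  by apply: (@circle_lip_measurable _ _ 1) => x y; rewrite mul1r.
by exists 1 => x; have /andP[p0 p1] := p01 x; rewrite ger0_norm.
Qed.

(** The test class with values in [-1, 1] instead of [0, 1]: the kernels [D (csub v u)] change
    sign. *)
Definition lip1 phi := (forall u, `|phi u| <= 1) /\
  (forall u v, `|phi u - phi v| <= mdist u v).

Lemma lip1_bmfun phi : lip1 phi -> bmfun phi.
Proof.
move=> [p1 plip]; split; last by exists 1.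
by apply: (@circle_lip_measurable _ _ 1) => x y; rewrite mul1r.
Qed.

Lemma BL1_lip1 phi : BL1 phi -> lip1 phi.
Proof.
by move=> [p01 plip]; split => // u; have /andP[p0 p1] := p01 u; rewrite ger0_norm.
Qed.

Lemma BL1_cst1 : BL1 (fun _ : circle => 1).
Proof. by split=> [u|u v]; rewrite ?ler01 ?lexx// subrr normr0 mdist_ge0. Qed.

Lemma lip1_BL1 phi : lip1 phi -> BL1 (fun u => (phi u + 1) / 2).
Proof.
move=> [p1 plip]; split=> [u|u v].
  by have := p1 u; rewrite ler_norml => /andP[h1 h2]; apply/andP; split; lra.
rewrite -mulrBl opprD addrACA subrr addr0 normrM.
rewrite (ger0_norm (_ : 0 <= 2^-1)) ?invr_ge0// (le_trans _ (plip u v))//.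
by rewrite ler_piMr// invf_le1// ler1n.
Qed.

Lemma dBL_ge mu nu phi : BL1 phi ->
  (`|\int[mu]_u phi u - \int[nu]_u phi u|%:E <= dBL mu nu)%E.
Proof.
move=> bphi; rewrite -abse_EFin EFinB !EFin_Rintegral; last 4 first.
- exact: finmeas_lty.
- exact: BL1_bmfun.
- exact: finmeas_lty.
- exact: BL1_bmfun.
by apply: ereal_sup_ubound; exists phi.
Qed.

Lemma dBL_ge0 mu nu : (0 <= dBL mu nu)%E.
Proof. by apply: le_trans (dBL_ge mu nu BL1_cst1); rewrite lee_fin. Qed.

(** Write [phi] as [2 * psi - 1] with [psi] in [BL1]: the factor 3 is 2 for [psi] plus 1 for the
    constant function. *)
Lemma dBL_ge_lip1 mu nu phi : lip1 phi ->
  (`|\int[mu]_u phi u - \int[nu]_u phi u|%:E <= 3%:E * dBL mu nu)%E.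
Proof.
move=> pl; have b1 := dBL_ge mu nu BL1_cst1.
have b2 := dBL_ge mu nu (lip1_BL1 pl).
have bp := lip1_bmfun pl.
have phiE (m : finmeas R) : \int[m]_u ((phi u + 1) / 2) =
    (\int[m]_u phi u + \int[m]_u 1) / 2.
  rewrite -bm_RintegralD; [|exact: finmeas_lty|exact: bp|exact: bmfun_cst].
  rewrite mulrC -bm_RintegralZ; [|exact: finmeas_lty|].
    by apply: eq_Rintegral => u _; rewrite mulrC.
  by apply: bmfunD => //; exact: bmfun_cst.
move: b1 b2; rewrite !phiE.
move: (\int[mu]_u phi u) (\int[nu]_u phi u) (\int[mu]_u 1) (\int[nu]_u 1) => a b c d.
have := dBL_ge0 mu nu; case: (dBL mu nu) => [r| |]//; last first.
  by move=> _ _ _; rewrite gt0_muley ?leey// lte_fin.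
rewrite !lee_fin => r0; rewrite !ler_norml => /andP[h1 h2] /andP[h3 h4].
by apply/andP; split; lra.
Qed.

Lemma dBL_le mu nu (c : R) :
  (forall phi, BL1 phi -> `|\int[mu]_u phi u - \int[nu]_u phi u| <= c) ->
  (dBL mu nu <= c%:E)%E.
Proof.
move=> h; apply: ge_ereal_sup => _ [phi bphi <-].
rewrite -!EFin_Rintegral ?lee_fin; try exact: finmeas_lty; try exact: BL1_bmfun.
exact: h.
Qed.

Context {d} {Omega : measurableType d}.
Implicit Type k : Omega -> finmeas R.

Lemma measurable_Rintegral_lip1 k phi :
  measurable_fun setT (k : Omega -> g_sigma_algebraType (@BL_open R)) ->
  lip1 phi -> measurable_fun setT (fun y => \int[k y]_u phi u).
Proof.
move=> mk pl; apply: open_preimage_measurable => U oU.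
rewrite -[X in measurable X]setTI.
apply: (mk measurableT [set mu : finmeas R | U (\int[mu]_u phi u)]).
apply: sub_sigma_algebra => mu /= Umu.
have /nbhs_ballP[/= e e0 he] := open_nbhs_nbhs (conj oU Umu).
exists (e / 3); first by rewrite divr_gt0.
move=> nu munu; apply: he; rewrite /ball /= -lte_fin.
apply: le_lt_trans (dBL_ge_lip1 mu nu pl) _.
rewrite (_ : e%:E = 3%:E * (e / 3)%:E)%E ?lte_pmul2l//.
by rewrite -EFinM mulrC divfK.
Qed.

Lemma Rintegral_indic (d' : measure_display) (T : measurableType d')
  (m : {measure set T -> \bar R}) (S : set T) : measurable S ->
  \int[m]_x \1_S x = fine (m S).
Proof. by move=> mS; rewrite /Rintegral integral_indic// setIT. Qed.

(* The indicator of an open set is the increasing limit of Lipschitz functions;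
   the general case is a Dynkin class argument. *)
Lemma measurable_finmeas k S :
  measurable_fun setT (k : Omega -> g_sigma_algebraType (@BL_open R)) ->
  measurable S -> measurable_fun setT (fun y => k y S).
Proof.
move=> mk mS.
have openP U : open U -> measurable_fun setT (fun y => k y U).
  move=> oU; have mU := circle_open_measurable oU.
  have -> : (fun y => k y U) = EFin \o (fun y => \int[k y]_u \1_U u).
    by apply/funext => y /=; rewrite Rintegral_indic// fineK// fin_num_measure.
  apply/measurable_EFinP.
  have i01 u : 0 <= (\1_U u : R) <= 1.
    by rewrite indicE; case: (_ \in _); rewrite ?ler01 ?lexx.
  have i1 u : `|\1_U u| <= 1 :> R by have /andP[i0 ?] := i01 u; rewrite ger0_norm.
  have menv n : measurable_fun setT (envelope (\1_U : circle -> R) n).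
    exact: (circle_lip_measurable (envelope_lip i1 n)).
  apply: (@measurable_fun_cvg _ _ _ _ (fun n y => \int[k y]_u envelope \1_U n u)).
    (* The envelope is [n]-Lipschitz and must be rescaled to enter [lip1]; dividing by [n.+1] also
       covers [n = 0]. *)
    move=> n; have sc y : \int[k y]_u envelope \1_U n u =
        n.+1%:R * \int[k y]_u (n.+1%:R^-1 * envelope \1_U n u).
      rewrite bm_RintegralZ; [|exact: finmeas_lty|].
        by rewrite mulrA mulfV ?mul1r// pnatr_eq0.
      by split => //; exists 1 => u; exact: envelope_norm.
    under eq_fun do rewrite sc.
    apply: measurable_funM; first exact: measurable_cst.
    apply: measurable_Rintegral_lip1 => //; split => [u|u v].
      rewrite normrM ger0_norm ?invr_ge0// mulr_ile1 ?invr_ge0//.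
        by rewrite invf_le1// ler1n.
      exact: envelope_norm.
    rewrite -mulrBr normrM ger0_norm ?invr_ge0//.
    rewrite ler_pdivrMl// (le_trans (envelope_lip i1 n u v))//.
    by rewrite ler_wpM2r ?mdist_ge0// ler_nat.
  move=> y _; apply: (@Rintegral_bounded_cvg _ _ _ _ _ _ 1).
  - exact: finmeas_lty.
  - exact: menv.
  - exact: bmfun_indic.
  - by move=> n u; exact: envelope_norm.
  apply: aeW => u.
  have [Uu|Uu] := boolP (u \in U).
    exact/(envelope_cvg i1)/indic_continuous/set_mem.
  rewrite (_ : (fun n => _) = (fun=> 0)); last first.
    apply/funext => n; apply/eqP; rewrite eq_le; apply/andP; split.
      by rewrite (le_trans (envelope_le i1 n u))// indicE (negbTE Uu).
    by apply: (envelope_ge i1) => v; case/andP: (i01 v).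
  by rewrite indicE (negbTE Uu); exact: cvg_cst.
apply: (@dynkin_induction _ _ (@open circle)
  (fun S => measurable_fun setT (fun y => k y S))) => //.
- by move=> A B; exact: openI.
- by apply: openP; exact: openT.
- move=> A mA hA.
  have -> : (fun y => k y (~` A)) = (fun y => k y setT - k y A)%E.
    apply/funext => y; rewrite -setTD measureD ?setTI//.
    exact: finmeas_lty.
  apply: emeasurable_funB => //; apply: openP; exact: openT.
- move=> F mF tF hF.
  have -> : (fun y => k y (\bigcup_n F n)) = (fun y => \sum_(0 <= n <oo) k y (F n))%E.
    apply/funext => y; rewrite measure_bigcup//; apply: eq_eseriesl => n; exact: mem_set.
  by apply: ge0_emeasurable_sum => n //; exact: hF.
Qed.

End measure_valued_maps.

(** * Arcs and Riemann sums on the circle *)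

Section arcs.
Context {R : realType}.
Local Notation circle := (circle R).

Definition arc (a b : R) : set circle := [set u | a <= angle u < b].

(** The circle distance on parameters in [0, 2 pi] with the right end included, since the last arc
    of a subdivision ends there. *)
Let cd (x y : R) := Num.min `|x - y| (2 * pi - `|x - y|).

Let cd_toCircle u b : 0 <= b <= 2 * pi -> mdist u (toCircle b) = cd (angle u) b.
Proof.
move=> /andP[b0]; rewrite le_eqVlt => /predU1P[->|b2].
  have -> : toCircle (2 * pi) = toCircle 0 :> circle.
    by apply: (@toCircle_eq _ _ _ (-1)); rewrite mulrN1 subrr.
  have E : angle (toCircle 0) = 0 :> R.
    by rewrite /= reduceE mul0r floor0 mulr0 subr0.
  have /andP[u0 u1] := angleP u.
  rewrite mdist_circleE /cdist E subr0 ger0_norm// /cd minC ler0_norm; last by lra.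
  by congr Num.min; lra.
rewrite mdist_circleE /cdist /=.
suff -> : reduce b = b by [].
rewrite reduceE (_ : Num.floor _ = 0) ?mulr0 ?subr0//.
apply/eqP; rewrite floor_eq ?divr_ge0 ?b0 ?(ltW (twopi_gt0 R))//=.
by rewrite add0r ltr_pdivrMr ?twopi_gt0// mul1r.
Qed.

(** A shortest path between a point outside the arc and a point inside crosses one of the two ends,
    so each point is at least as close to an end as to the other point. *)
Let cd_arc x y a b : 0 <= a -> a <= b -> b <= 2 * pi -> 0 <= x < 2 * pi ->
  0 <= y < 2 * pi -> a <= y < b -> ~~ (a <= x < b) ->
  Num.min (cd x a) (cd x b) <= cd x y /\ Num.min (cd y a) (cd y b) <= cd x y.
Proof.
move=> a0 ab b2 /andP[x0 x1] /andP[y0 y1] /andP[ay yb] xab.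
have {xab} xab : x < a \/ b <= x.
  by move: xab; rewrite negb_and -ltNge -leNgt => /orP[]; [left|right].
rewrite /cd !le_min !ge_min.
case: xab => h.
- rewrite (ler0_norm (_ : x - a <= 0)) ?subr_le0 ?(ltW h)//.
  rewrite (ler0_norm (_ : x - b <= 0)); last by lra.
  rewrite (ler0_norm (_ : x - y <= 0)); last by lra.
  rewrite (ger0_norm (_ : 0 <= y - a)); last by lra.
  rewrite (ler0_norm (_ : y - b <= 0)); last by lra.
  split; apply/andP; split; rewrite -?orbA.
  - by apply/orP; left; lra.
  - by apply/orP; right; apply/orP; right; apply/orP; right; lra.
  - by apply/orP; left; lra.
  - by apply/orP; right; apply/orP; right; apply/orP; left; lra.
- rewrite (ger0_norm (_ : 0 <= x - a)); last by lra.
  rewrite (ger0_norm (_ : 0 <= x - b)); last by lra.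
  rewrite (ger0_norm (_ : 0 <= x - y)); last by lra.
  rewrite (ger0_norm (_ : 0 <= y - a)); last by lra.
  rewrite (ler0_norm (_ : y - b <= 0)); last by lra.
  split; apply/andP; split; rewrite -?orbA.
  - by apply/orP; right; apply/orP; right; apply/orP; left; lra.
  - by apply/orP; right; apply/orP; left; lra.
  - by apply/orP; right; apply/orP; right; apply/orP; left; lra.
  - by apply/orP; left; lra.
Qed.

Lemma boundary_arc a b : 0 <= a -> a <= b -> b <= 2 * pi ->
  boundary (arc a b) `<=` [set toCircle a; toCircle b].
Proof.
move=> a0 ab b2 u [cu iu]; apply: contrapT => /not_orP[/= ua ub].
have a2 : 0 <= a <= 2 * pi by rewrite a0 (le_trans ab).
have b02 : 0 <= b <= 2 * pi by rewrite b2 andbT (le_trans a0).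
pose r := Num.min (cd (angle u) a) (cd (angle u) b).
have r0 : 0 < r.
  by rewrite /r -!cd_toCircle// lt_min !mdist_gt0; apply/andP; split; exact/eqP.
have [uab|uab] := boolP (a <= angle u < b).
  apply: iu; apply/nbhs_ballP; exists r => // v; rewrite ballEmdist /= => uv.
  apply/negPn/negP => vab.
  have [_] := cd_arc a0 ab b2 (angleP v) (angleP u) uab vab.
  by rewrite leNgt => /negP; apply; rewrite -/r -[cd _ _]mdist_circleE metric_sym.
have /nbhs_ballP : nbhs_ball u (ball u r) by exists r.
move=> /cu[v [vab]]; rewrite ballEmdist /= => uv.
have [+ _] := cd_arc a0 ab b2 (angleP u) (angleP v) vab uab.
by rewrite leNgt => /negP; apply.
Qed.

Lemma lambda_boundary_arc a b : 0 <= a -> a <= b -> b <= 2 * pi ->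
  lambda (boundary (arc a b)) = 0%E.
Proof.
move=> a0 ab b2; rewrite /lambda; apply: countable_lebesgue_measure0.
apply: finite_set_countable; apply: finite_image.
exact: sub_finite_set (boundary_arc a0 ab b2) (finite_set2 _ _).
Qed.

Lemma measurable_arc a b : 0 <= a -> a <= b -> b <= 2 * pi -> measurable (arc a b).
Proof.
move=> a0 ab b2.
have -> : arc a b = (arc a b)° `|` (arc a b `&` boundary (arc a b)).
  apply/seteqP; split => u; last by case=> [|[]//]; exact: interior_subset.
  move=> uab; have [|iu] := pselect ((arc a b)° u); first by left.
  by right; split=> //; split=> //; exact: subset_closure.
apply: measurableU; first by apply: circle_open_measurable; exact: open_interior.
have : finite_set (arc a b `&` boundary (arc a b)).
  apply: sub_finite_set (finite_set2 (toCircle a) (toCircle b)).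
  by move=> u [_]; exact: boundary_arc.
move: (_ `&` _) => F finF; rewrite -[F]setCK; apply: measurableC.
apply: circle_open_measurable; rewrite openC.
have /accessible_finite_set_closed := hausdorff_accessible (@metric_hausdorff _ circle).
exact.
Qed.

Variables (N : nat).
Hypothesis N0 : (0 < N)%N.

Definition mesh : R := 2 * pi / N%:R.

Definition cell (i : 'I_N) : set circle := arc (mesh * i%:R) (mesh * i.+1%:R).

Let mesh_gt0 : 0 < mesh.
Proof. by rewrite divr_gt0 ?twopi_gt0// ltr0n. Qed.

Let cell_bounds (i : 'I_N) : [/\ 0 <= mesh * i%:R,
  mesh * i%:R <= mesh * i.+1%:R & mesh * i.+1%:R <= 2 * pi].
Proof.
split; first by rewrite mulr_ge0// ltW.
  by rewrite ler_pM2l// ler_nat.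
rewrite /mesh mulrAC ler_pdivrMr ?ltr0n// ler_pM2l ?twopi_gt0// ler_nat.
exact: ltn_ord.
Qed.

Lemma measurable_cell i : measurable (cell i).
Proof. by have [? ? ?] := cell_bounds i; exact: measurable_arc. Qed.

Lemma lambda_boundary_cell i : lambda (boundary (cell i)) = 0%E.
Proof. by have [? ? ?] := cell_bounds i; exact: lambda_boundary_arc. Qed.

(** A Riemann sum with nodes at the left ends of the cells, which partition the circle. The error is
    the same for all [phi] in [lip1], so one finite family of sets serves every kernel. *)
Lemma Rintegral_cells (mu : {measure set circle -> \bar R}) (b : R) phi :
  (mu setT <= b%:E)%E -> lip1 phi ->
  `|\int[mu]_u phi u - \sum_(i < N) phi (toCircle (mesh * i%:R)) * fine (mu (cell i))|
   <= mesh * b.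
Proof.
move=> mub pl; have fmu : (mu setT < +oo)%E by exact: le_lt_trans (ltry b).
have bF (i : 'I_N) : bmfun (fun u => phi (toCircle (mesh * i%:R)) * \1_(cell i) u).
  by apply: bmfunZ; apply: bmfun_indic; exact: measurable_cell.
have -> : \sum_(i < N) phi (toCircle (mesh * i%:R)) * fine (mu (cell i)) =
    \int[mu]_u (\sum_(i < N) phi (toCircle (mesh * i%:R)) * \1_(cell i) u).
  rewrite bm_Rintegral_sum//; apply: eq_bigr => i _.
  rewrite bm_RintegralZ//; last by apply: bmfun_indic; exact: measurable_cell.
  by rewrite Rintegral_indic//; exact: measurable_cell.
rewrite -bm_RintegralB//; [|exact: lip1_bmfun|exact: bmfun_sum].
apply: Rintegral_norm_le => //.
  by apply: bmfunB; [exact: lip1_bmfun|exact: bmfun_sum].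
move=> u; have /andP[u0 u1] := angleP u.
pose n := Num.truncn (angle u / mesh).
have /andP[n1 n2] : n%:R <= angle u / mesh < n.+1%:R.
  by apply: truncn_itv; rewrite divr_ge0// ltW.
move: n1 n2; rewrite ler_pdivlMr// ltr_pdivrMr// ![_ * mesh]mulrC => n1 n2.
have nN : (n < N)%N.
  rewrite -(ltr_nat R) -(ltr_pM2l mesh_gt0) (le_lt_trans n1)// (lt_le_trans u1)//.
  by rewrite /mesh divfK// pnatr_eq0 -lt0n.
rewrite (bigD1 (Ordinal nN))//= big1 ?addr0 => [|i iN]; last first.
  rewrite indicE memNset ?mulr0// => /= /andP[h1 h2].
  have : (i <= n)%N.
    by rewrite -ltnS -(ltr_nat R) -(ltr_pM2l mesh_gt0) (le_lt_trans h1).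
  have : (n <= i)%N.
    by rewrite -ltnS -(ltr_nat R) -(ltr_pM2l mesh_gt0) (le_lt_trans n1).
  move=> a1 a2; move/eqP: iN; apply; apply: val_inj => /=.
  by apply/eqP; rewrite eqn_leq a1 a2.
rewrite indicE mem_set/= ?mulr1; last by rewrite /cell /arc /= n1 n2.
rewrite (le_trans (pl.2 _ _))// -[X in mdist X _]toCircleK.
rewrite (le_trans (mdist_toCircle _ _))// ger0_norm ?subr_ge0//.
by move: n2; rewrite -natr1 mulrDr mulr1; lra.
Qed.

End arcs.

(** * Fiber measures of a graphop *)

Section graphop_fibers.
Context {d} {Omega : measurableType d} {R : realType}.
Variables (m : probability Omega R) (A : graphop m).
Hypothesis A1 : (gamma A <= 1)%E.

Lemma fiber_le1 x : (fiber A x setT <= 1)%E.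
Proof. by apply: le_trans A1; apply: ereal_sup_ubound; exists x. Qed.

Lemma fiber_lty x : (fiber A x setT < +oo)%E.
Proof. exact: le_lt_trans (fiber_le1 x) (ltry 1). Qed.

Lemma prob_lty : (m setT < +oo)%E.
Proof. by rewrite probability_setT ltry. Qed.

Lemma bmfun_fiber f : bmfun f -> bmfun (fun x => \int[fiber A x]_y f y).
Proof.
move=> bf; have [mf [M fM]] := bf; split; last first.
  exists (M * 1) => x; apply: Rintegral_norm_le => //; exact: fiber_le1.
have ge0 g : bmfun g -> (forall x, 0 <= g x) ->
    measurable_fun setT (fun x => \int[fiber A x]_y g y).
  move=> bg g0; apply/measurable_EFinP.
  rewrite (_ : _ \o _ = (fun x => \int[fiber A x]_y (g y)%:E)%E).
    apply: measurable_fun_integral_kernel.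
    - by move=> U mU; exact: measurable_kernel.
    - by move=> z; rewrite lee_fin.
    - by apply/measurable_EFinP; case: bg.
  by apply/funext => x /=; rewrite EFin_Rintegral//; exact: fiber_lty.
have fE x : \int[fiber A x]_y f y =
    \int[fiber A x]_y (f y + M) - \int[fiber A x]_y M.
  rewrite bm_RintegralD//; [|exact: fiber_lty|exact: bmfun_cst].
  by rewrite addrK.
under eq_fun do rewrite fE.
have M0 : 0 <= M by exact: le_trans (fM point).
apply: measurable_funB; apply: ge0 => //; last exact: bmfun_cst.
  by apply: bmfunD => //; exact: bmfun_cst.
by move=> x; have := fM x; rewrite ler_norml => /andP[]; lra.
Qed.

Lemma bmfun_Linf f : bmfun f ->
  exists v : LfunType m (leey 1%E), (v : Omega -> R) = f.
Proof.
move=> [mf [M fM]].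
have fL : f \in Lfun m +oo%E.
  apply/andP; split; first by rewrite inE.
  rewrite inE/= /finite_norm unlock /= probability_setT lte01.
  apply: le_lt_trans (ltry M); apply/ess_supP; apply: aeW => x /=.
  by rewrite lee_fin.
by exists (@Lfun_Sub _ _ _ _ _ (leey 1%E) f fL).
Qed.

(* Self-adjointness against the constant function 1. *)
Lemma Rintegral_fiber_le f : bmfun f -> (forall x, 0 <= f x) ->
  \int[m]_x (\int[fiber A x]_y f y) <= \int[m]_x f x.
Proof.
move=> bf f0; have [v vE] := bmfun_Linf bf.
have [w wE] := bmfun_Linf (@bmfun_cst _ Omega _ (1 : R)).
have := graphop_selfadjoint A v w; rewrite vE wE.
have mA u : measurable_fun setT (graphop_fun A u).
  exact: measurable_funP.
have b1 := @bmfun_cst _ Omega R 1.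
have fib_meas g : bmfun g -> measurable_fun setT (fun x => (\int[fiber A x]_y g y)%:E).
  by move=> /bmfun_fiber[mg _]; exact/measurable_EFinP.
have -> : (\int[m]_x (graphop_fun A v x * 1)%:E =
    \int[m]_x (\int[fiber A x]_y f y)%:E)%E.
  apply: ae_eq_integral => //.
  - by apply/measurable_EFinP; apply: measurable_funM.
  - exact: fib_meas.
  - apply: filterS (graphop_fiber A v) => x + _; rewrite mulr1 => ->.
    by rewrite vE EFin_Rintegral//; exact: fiber_lty.
have -> : (\int[m]_x (f x * graphop_fun A w x)%:E =
    \int[m]_x (f x * \int[fiber A x]_y 1)%:E)%E.
  apply: ae_eq_integral => //.
  - by apply/measurable_EFinP; apply: measurable_funM => //; case: bf.
  - apply/measurable_EFinP; apply: measurable_funM; first by case: bf.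
    by case: (bmfun_fiber b1).
  - apply: filterS (graphop_fiber A w) => x h _; congr EFin; congr (_ * _).
    apply: EFin_inj; rewrite h wE EFin_Rintegral//; exact: fiber_lty.
have bfib := bmfun_fiber bf; have bfib1 := bmfun_fiber b1.
rewrite -!EFin_Rintegral//; try exact: prob_lty; last exact: bmfunM.
move=> -[->]; apply: bm_le_Rintegral => //; [exact: prob_lty|exact: bmfunM|].
move=> x; rewrite ler_piMr// Rintegral_cst// mul1r -lee_fin fineK.
  exact: fiber_le1.
by rewrite ge0_fin_numE// fiber_lty.
Qed.

(** By [Rintegral_fiber_le] the nonnegative function [fiber A x U] has zero [m]-integral. The
    exceptional set of [x] depends on [U]. *)
Lemma fiber_null (U : set Omega) : measurable U -> m U = 0%E ->
  {ae m, forall x, fiber A x U = 0%E}.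
Proof.
move=> mU mU0; have b1 := @bmfun_indic _ _ R _ mU.
have h : \int[m]_x (\int[fiber A x]_y \1_U y) <= 0.
  apply: le_trans (Rintegral_fiber_le b1 _) _; first by move=> x; rewrite indicE.
  have -> : \int[m]_x \1_U x = fine (m U) by exact: Rintegral_indic.
  by rewrite mU0.
have g0 x : 0 <= \int[fiber A x]_y \1_U y.
  by apply: Rintegral_ge0 => y _; rewrite indicE.
have [+ _] := @ae_eq_integral_abs _ _ _ m setT measurableT
  (fun x => (\int[fiber A x]_y \1_U y)%:E)
  ((measurable_EFinP _ _).2 (bmfun_fiber b1).1).
have -> : (\int[m]_x `|(\int[fiber A x]_y \1_U y)%:E| = 0)%E.
  under eq_integral do rewrite abse_EFin ger0_norm//.
  rewrite -EFin_Rintegral; [|exact: prob_lty|exact: bmfun_fiber].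
  by congr EFin; apply/eqP; rewrite eq_le h Rintegral_ge0.
move=> /(_ erefl); apply: filterS => x /(_ I) /= [].
rewrite Rintegral_indic// => hx; rewrite -[LHS]fineK ?hx//.
rewrite ge0_fin_numE// (le_lt_trans _ (fiber_lty x))//.
by apply: le_measure => //; rewrite inE.
Qed.

Variables (b : R) (mu : Omega -> finmeas R).
Hypothesis muM : Mbar b mu.

Let mass x S : measurable S -> (mu x S <= b%:E)%E.
Proof. by move=> mS; apply: le_trans (muM.2 x); apply: le_measure => //; rewrite inE. Qed.

Let b0 : 0 <= b.
Proof. by rewrite -lee_fin; apply: le_trans (muM.2 point). Qed.

Lemma bmfun_finmeas S : measurable S -> bmfun (fun y => fine (mu y S)).
Proof.
move=> mS; split.
  by apply: measurableT_comp => //; exact: measurable_finmeas muM.1 mS.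
exists b => y; rewrite ger0_norm ?fine_ge0// -lee_fin fineK ?fin_num_measure//.
exact: mass.
Qed.

Lemma bmfun_Rintegral_lip1 phi : lip1 phi -> bmfun (fun y => \int[mu y]_u phi u).
Proof.
move=> pl; split; first exact: measurable_Rintegral_lip1 muM.1 pl.
exists (1 * b) => y; apply: Rintegral_norm_le => //; [exact: muM.2|exact: lip1_bmfun|].
by case: pl.
Qed.

Lemma fiber_integral_cells N phi x : (0 < N)%N -> lip1 phi ->
  `|\int[fiber A x]_y (\int[mu y]_u phi u) -
    \sum_(i < N) phi (toCircle (mesh N * i%:R)) *
      \int[fiber A x]_y fine (mu y (cell i))| <= mesh N * b.
Proof.
move=> N0 pl.
have bc (i : 'I_N) : bmfun (fun y => fine (mu y (cell i))).
  by apply: bmfun_finmeas; exact: measurable_cell.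
have bF (i : 'I_N) : bmfun (fun y => phi (toCircle (mesh N * i%:R)) * fine (mu y (cell i))).
  exact: bmfunZ.
have ZE (i : 'I_N) : phi (toCircle (mesh N * i%:R)) * \int[fiber A x]_y fine (mu y (cell i)) =
    \int[fiber A x]_y (phi (toCircle (mesh N * i%:R)) * fine (mu y (cell i))).
  by rewrite bm_RintegralZ//; exact: fiber_lty.
under eq_bigr do rewrite ZE.
rewrite -bm_Rintegral_sum//; last exact: fiber_lty.
rewrite -bm_RintegralB//; [|exact: fiber_lty|exact: bmfun_Rintegral_lip1|exact: bmfun_sum].
rewrite -[leRHS]mulr1; apply: Rintegral_norm_le; first exact: fiber_le1.
  by apply: bmfunB; [exact: bmfun_Rintegral_lip1|exact: bmfun_sum].
by move=> y; apply: Rintegral_cells => //; exact: muM.2.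
Qed.

Let ext0 x : extension A mu x set0 = 0%E.
Proof. by apply: integral0_eq => y _; rewrite measure0. Qed.

Let ext_ge0 x S : (0 <= extension A mu x S)%E.
Proof. by apply: integral_ge0 => y _; exact: measure_ge0. Qed.

Let ext_additive x : semi_sigma_additive (extension A mu x).
Proof.
move=> F mF tF mUF.
have -> : extension A mu x (\bigcup_n F n) = (\sum_(0 <= n <oo) extension A mu x (F n))%E.
  rewrite -integral_nneseries//; last by move=> n; exact: measurable_finmeas muM.1 (mF n).
  apply: eq_integral => y _; rewrite measure_bigcup//.
  by apply: eq_eseriesl => n; exact: mem_set.
by apply: is_cvg_ereal_nneg_natsum => n _; exact: ext_ge0.
Qed.

(* Both sides are within [mesh N * b] of the same sum over the cells. *)
Lemma Rintegral_extension x phi : lip1 phi ->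
  fine (\int[extension A mu x]_u (phi u)%:E)%E =
  \int[fiber A x]_y (\int[mu y]_u phi u).
Proof.
move=> pl.
pose mm := isMeasure.Build _ _ _ (extension A mu x) (ext0 x) (ext_ge0 x)
  (@ext_additive x).
pose kappa : {measure set (circle R) -> \bar R} := HB.pack (extension A mu x) mm.
have kE : \int[kappa]_u phi u = fine (\int[extension A mu x]_u (phi u)%:E)%E by [].
rewrite -kE; apply/eqP; rewrite -subr_eq0; apply/eqP.
have kb : (kappa setT <= b%:E)%E.
  rewrite -[kappa setT]/(\int[fiber A x]_y mu y setT)%E.
  apply: (@le_trans _ _ (\int[fiber A x]_y b%:E)%E).
    by apply: ge0_le_lower_integral => y //; exact: muM.2.
  by rewrite integral_cst//= -[leRHS]mule1 lee_wpmul2l ?lee_fin// fiber_le1.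
(* With [2 ^ k] cells each of the two quadrature errors is [2 * pi * b * 2 ^- k]. *)
apply: (@le_geometric_eq0 _ _ (2 * pi * b * 2)) => k.
have N0 : (0 < 2 ^ k)%N by rewrite expn_gt0.
have h1 := Rintegral_cells N0 kb pl.
have h2 := fiber_integral_cells x N0 pl.
have cE (i : 'I_(2 ^ k)) : fine (kappa (cell i)) = \int[fiber A x]_y fine (mu y (cell i)).
  congr fine; apply: eq_integral => y _ /=.
  by rewrite fineK ?fin_num_measure//; exact: measurable_cell.
have -> : 2 * pi * b * 2 * 2 ^- k = mesh (2 ^ k) * b + mesh (2 ^ k) * b :> R.
  by rewrite /mesh natrX; ring.
move: h1 h2; under eq_bigr do rewrite cE.
move: (\sum_(i < _) _) (_ * b) => s e.
by rewrite !ler_norml => /andP[? ?] /andP[? ?]; apply/andP; split; lra.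
Qed.

End graphop_fibers.

(** * Solutions as images under forward flows *)

Section solution_lift.
Context {d} {Omega : measurableType d} {R : realType}.
Variables (m : probability Omega R) (T b C : R) (D : circle R -> R).
Variables (A : graphop m) (mu0 : Omega -> finmeas R) (mu : R -> Omega -> finmeas R).

(* [P y x] is a real lift of the trajectory at [y] starting at [x]; the last
   clause says that [mu t y] is the image of [mu0 y] under the flow. *)
Definition solution_lift (P : Omega -> R -> R -> R) : Prop :=
  [/\ forall y x, P y x 0 = x,
      forall y x t, 0 <= t <= T -> is_derive t 1 (P y x)
        (C * \int[fiber A y]_z (\int[mu t z]_v D (csub v (toCircle (P y x t))))),
      forall y x s t, 0 <= s -> s <= t -> t <= T ->
        `|P y x t - P y x s| <= C * b * (t - s),
      (forall y t, 0 <= t <= T ->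
        measurable_fun setT (fun u => toCircle (P y (angle u) t))) &
      forall y t phi, 0 <= t <= T -> lip1 phi ->
        \int[mu t y]_u phi u = \int[mu0 y]_u phi (toCircle (P y (angle u) t))].

End solution_lift.

Section solution.
Context {d} {Omega : measurableType d} {R : realType}.
Variables (m : probability Omega R) (T b C : R) (D : circle R -> R).
Variables (A : graphop m) (mu0 : Omega -> finmeas R) (mu : R -> Omega -> finmeas R).
Hypotheses (T0 : 0 < T) (b0 : 0 < b) (C0 : 0 < C).
Hypothesis D_lip : forall u v, `|D u - D v| <= mdist u v.
Hypothesis D_bd : forall u, `|D u| <= 1.
Hypothesis A1 : (gamma A <= 1)%E.
Hypothesis mu0M : Mbar b mu0.
Hypothesis muM : MbarT b T mu.
Hypothesis muF : fixed_point T C D A mu0 mu.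

Lemma lip1_kernel u : lip1 (fun v => D (csub v u)).
Proof.
by split => [v|v w]; [exact: D_bd|rewrite (le_trans (D_lip _ _))// mdist_csubl].
Qed.

Let muMt t : 0 <= t <= T -> Mbar b (mu t).
Proof. by move=> /muM[]. Qed.

Let V x t u := velocity C D A mu x t u.

Let VE x t u : 0 <= t <= T ->
  V x t u = C * \int[fiber A x]_y (\int[mu t y]_v D (csub v u)).
Proof.
move=> tT; rewrite /V /velocity; congr (_ * _).
by rewrite (Rintegral_extension A1 (muMt tT)); [|exact: lip1_kernel].
Qed.

Let L := C * b.

Let L0 : 0 <= L.
Proof. by rewrite mulr_ge0 ?ltW. Qed.

Let inner_bd t u y : 0 <= t <= T -> `|\int[mu t y]_v D (csub v u)| <= b.
Proof.
move=> tT; rewrite -[leRHS]mul1r; apply: Rintegral_norm_le.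
- exact: (muMt tT).2.
- exact/lip1_bmfun/lip1_kernel.
- by move=> v; exact: D_bd.
Qed.

Let bm_inner t u : 0 <= t <= T -> bmfun (fun y => \int[mu t y]_v D (csub v u)).
Proof.
by move=> tT; apply: (bmfun_Rintegral_lip1 (muMt tT)); exact: lip1_kernel.
Qed.

Let V_bd x t u : 0 <= t <= T -> `|V x t u| <= L.
Proof.
move=> tT; rewrite VE// normrM gtr0_norm// ler_pM2l// -[leRHS]mulr1.
apply: Rintegral_norm_le; first exact: fiber_le1.
  exact: bm_inner.
by move=> y; exact: inner_bd.
Qed.

Let V_lip x t u w : 0 <= t <= T -> `|V x t u - V x t w| <= L * mdist u w.
Proof.
move=> tT; rewrite !VE// -mulrBr normrM gtr0_norm// -mulrA ler_pM2l//.
rewrite -bm_RintegralB; [|exact: fiber_lty|exact: bm_inner|exact: bm_inner].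
rewrite -[leRHS]mulr1; apply: Rintegral_norm_le; first exact: fiber_le1.
  by apply: bmfunB; exact: bm_inner.
have bk z : bmfun (fun v => D (csub v z)) by exact/lip1_bmfun/lip1_kernel.
move=> y; rewrite -bm_RintegralB//; try exact: finmeas_lty.
rewrite mulrC; apply: Rintegral_norm_le; first exact: (muMt tT).2.
  exact: bmfunB.
by move=> v; rewrite (le_trans (D_lip _ _))// mdist_csubr.
Qed.

(** The supremum defining [dbar] contains the integral of [dBL] against the fiber of [A] at [x], so
    continuity of the curve in [dbar] controls the velocity in time. The factor 3 is that of
    [dBL_ge_lip1]. *)
Let V_time x s t u (e : R) : 0 <= s <= T -> 0 <= t <= T ->
  (dbar (mu s) (mu t) <= e%:E)%E -> `|V x s u - V x t u| <= C * (3 * e).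
Proof.
move=> sT tT de; rewrite !VE// -mulrBr normrM gtr0_norm// ler_pM2l//.
have bB : bmfun (fun y => \int[mu s y]_v D (csub v u) - \int[mu t y]_v D (csub v u)).
  by apply: bmfunB; exact: bm_inner.
rewrite -bm_RintegralB; [|exact: fiber_lty|exact: bm_inner|exact: bm_inner].
apply: le_trans (bm_norm_Rintegral (fiber_lty A1 x) bB) _.
(* The factor is split off on the side of the measurable integrand, so that the integral of [dBL] is
   only compared by monotonicity. *)
rewrite -[leLHS](_ : 3 * \int[fiber A x]_y (3^-1 *
    `|\int[mu s y]_v D (csub v u) - \int[mu t y]_v D (csub v u)|) = _); last first.
  rewrite bm_RintegralZ ?mulrA ?mulfV ?mul1r//; first exact: fiber_lty.
  exact: bmfun_norm.
rewrite ler_pM2l// -lee_fin EFin_Rintegral; last 2 first.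
- exact: fiber_lty.
- by apply: bmfunZ; exact: bmfun_norm.
apply: le_trans de; apply: (@le_trans _ _ (\int[fiber A x]_y dBL (mu s y) (mu t y))%E).
  apply: ge0_le_lower_integral => y; first by rewrite lee_fin mulr_ge0// invr_ge0.
  rewrite EFinM lee_pdivrMl//; apply: dBL_ge_lip1; exact: lip1_kernel.
by apply: ereal_sup_ubound; exists m, A, x.
Qed.

Let V_cont x u : continuous (fun t => V x (clamp T t) u).
Proof.
move=> t; apply/cvgrPdist_le => e e0.
have tT := clamp_itv (ltW T0) t; have [_ mucvg] := muM tT.
have d0 : 0 < e / (3 * C) by rewrite divr_gt0// mulr_gt0.
have : nbhs (0%E : \bar R) [set r | (r < (e / (3 * C))%:E)%E].
  by apply: open_nbhs_nbhs; split; [exact: open_ereal_lt_ereal|rewrite /= lte_fin].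
move=> /mucvg /nbhs_ballP[r /= r0 hr].
apply/nbhs_ballP; exists r => // s; rewrite /ball /= => ts.
rewrite distrC; have sT := clamp_itv (ltW T0) s.
have -> : e = C * (3 * (e / (3 * C))) by field; rewrite gt_eqF.
apply: V_time => //; apply/ltW/(hr (clamp T s)); last by rewrite /= in_itv.
by rewrite /ball /= (le_lt_trans (clamp_lip (ltW T0) _ _)).
Qed.

Lemma solution_flow : exists P, solution_lift T b C D A mu0 mu P.
Proof.
have /choice[P PP] := fun y => flow_lift L0 (ltW T0) (@V_lip y) (@V_bd y) (@V_cont y).
have P0 y x : P y x 0 = x by have [] := PP y.
have Pd y x t : 0 <= t <= T -> is_derive t 1 (P y x) (V y t (toCircle (P y x t))).
  by have [_ + _ _ _] := PP y; exact.
have mP y t : 0 <= t <= T ->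
    measurable_fun setT (fun u => toCircle (P y (angle u) t)).
  move=> tT; have [_ _ Plip Pper _] := PP y.
  pose F u := toCircle (P y (angle u) t).
  (* [angle] jumps at 0, so the bound is taken at the lift of [v] nearest to [angle u];
     [toCircle (P y x t)] depends on [x] only through [toCircle x]. *)
  have F_lip u v : mdist (F u) (F v) <= expR (L * t) * mdist u v.
    have [z zv uz] := cdist_lift (angle u) v; rewrite toCircleK in uz.
    have -> : F v = toCircle (P y z t) by apply: Pper; rewrite ?toCircleK.
    by rewrite (le_trans (mdist_toCircle _ _))// -uz mulrC Plip.
  apply: (@measurability _ _ _ _ _ _ (@open (circle R))) => //.
  move=> _ [U oU <-]; rewrite setTI; apply: circle_open_measurable.
  apply: open_comp => // u _ W /nbhs_ballP[r /= r0 rW]; apply/nbhs_ballP.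
  exists (r / expR (L * t)); first by rewrite /= divr_gt0// expR_gt0.
  move=> v; rewrite ballEmdist /= ltr_pdivlMr ?expR_gt0// => uv.
  by apply: rW; rewrite ballEmdist /= (le_lt_trans (F_lip _ _))// mulrC.
exists P; split => //.
- by move=> y x t tT; rewrite -VE//; exact: Pd.
- move=> y x s t s0 st tT.
  have sub u : s <= u <= t -> 0 <= u <= T.
    by move=> /andP[su ut]; rewrite (le_trans s0) //= (le_trans ut).
  rewrite mulrBr; apply: (@dist_le_primitive _ _ (fun t => V y t (toCircle (P y x t)))
      (fun t => L * t) (fun=> L)) => //.
  + apply: derivable_within_continuous => u; rewrite in_itv/= => /sub uT.
    exact: (@ex_derive _ _ _ _ _ _ _ (Pd y x u uT)).
  + by apply: continuous_subspaceT => u; apply: cvgM; [exact: cvg_cst|exact: cvg_id].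
  + by move=> u; rewrite in_itv/= => /andP[/ltW su /ltW ut]; apply: Pd; apply: sub; rewrite su.
  + by move=> u _; apply: is_derive_eq; rewrite /GRing.scale/= mulr1.
  + by move=> u; rewrite in_itv/= => /andP[/ltW su /ltW ut]; apply: V_bd; apply: sub; rewrite su.
- move=> y t phi tT pl; have [_ _ _ _ Pim] := PP y.
  pose F u := toCircle (P y (angle u) t).
  pose Fm : {mfun circle R >-> circle R} := HB.pack F (isMeasurableFun.Build _ _ _ _ F (mP y t tT)).
  have bp := lip1_bmfun pl.
  rewrite /Rintegral; congr fine.
  (* The direct image of [S] under the backward flow is the preimage of [S] under [F], hence
     [mu t y] is the pushforward of [mu0 y]. *)
  rewrite (eq_measure_integral (pushforward (mu0 y) Fm)); last first.
    by move=> S mS _; have := muF y tT mS; rewrite Pim.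
  rewrite integral_pushforward//.
  + by apply/measurable_EFinP; case: bp.
  + apply: bmfun_integrable; first exact: finmeas_lty.
    split; first by apply: measurableT_comp; [case: bp|exact: (mP y t tT)].
    by exists 1 => u; exact: pl.1.
Qed.

End solution.

(** * The gap between two solutions *)

Section gap.
Context {d} {Omega : measurableType d} {R : realType}.
Variables (m : probability Omega R) (T b C : R) (D : circle R -> R).
Variable mu0 : Omega -> finmeas R.
Hypotheses (b0 : 0 < b) (C0 : 0 < C).
Hypothesis D_lip : forall u v, `|D u - D v| <= mdist u v.
Hypothesis D_bd : forall u, `|D u| <= 1.
Hypothesis mu0M : Mbar b mu0.

(** Both measures are images of [mu0 z], which couples them through the starting point. Two times
    are allowed so that the lemma also compares one solution with itself at different times. *)
Lemma transport_gap (A' A : graphop m) (mu' mu : R -> Omega -> finmeas R) P' P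
    z s t phi (c : R) :
  solution_lift T b C D A' mu0 mu' P' -> solution_lift T b C D A mu0 mu P ->
  0 <= s <= T -> 0 <= t <= T -> lip1 phi -> (forall x, `|P' z x s - P z x t| <= c) ->
  `|\int[mu' s z]_u phi u - \int[mu t z]_u phi u| <= c * b.
Proof.
move=> [_ _ _ mP' PP'] [_ _ _ mP PP] sT tT pl h.
rewrite PP'// PP//; have [mphi _] := lip1_bmfun pl.
have bF (Q : Omega -> R -> R -> R) r :
    measurable_fun setT (fun u => toCircle (Q z (angle u) r)) ->
    bmfun (fun u => phi (toCircle (Q z (angle u) r))).
  by move=> mQ; split; [exact: measurableT_comp|exists 1 => u; exact: pl.1].
have bF1 := bF _ _ (mP' z s sT); have bF2 := bF _ _ (mP z t tT).
rewrite -bm_RintegralB//; last exact: finmeas_lty.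
apply: Rintegral_norm_le; [exact: mu0M.2|exact: bmfunB|move=> u].
by rewrite (le_trans (pl.2 _ _))// (le_trans (mdist_toCircle _ _)).
Qed.

Lemma dBL_gap (A' A : graphop m) (mu' mu : R -> Omega -> finmeas R) P' P t z (c : R) :
  solution_lift T b C D A' mu0 mu' P' -> solution_lift T b C D A mu0 mu P ->
  0 <= t <= T -> (forall x, `|P' z x t - P z x t| <= c) ->
  (dBL (mu' t z) (mu t z) <= (c * b)%:E)%E.
Proof.
move=> S' S tT h; apply: dBL_le => phi /BL1_lip1 pl.
exact: (transport_gap S' S tT tT pl h).
Qed.

Variables (A' A : graphop m) (mu' mu : R -> Omega -> finmeas R).
Variables (P' P : Omega -> R -> R -> R).
Hypotheses (A'1 : (gamma A' <= 1)%E) (A1 : (gamma A <= 1)%E).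
Hypotheses (S' : solution_lift T b C D A' mu0 mu' P')
  (S : solution_lift T b C D A mu0 mu P).
Hypotheses (mu'M : MbarT b T mu') (muM : MbarT b T mu).
Let L := C * b.

(** Both fibers integrate the same [mu], so no information on [mu'] is needed to make this small. *)
Definition cell_gap (N : nat) (t : R) (y : Omega) : R :=
  \sum_(i < N) `|\int[fiber A' y]_z fine (mu t z (cell i)) -
                 \int[fiber A y]_z fine (mu t z (cell i))|.

Let M' t : 0 <= t <= T -> Mbar b (mu' t). Proof. by move=> /mu'M[]. Qed.
Let M t : 0 <= t <= T -> Mbar b (mu t). Proof. by move=> /muM[]. Qed.

Let L0 : 0 <= L.
Proof. by rewrite mulr_ge0 ?ltW. Qed.

Let fiber_diff N t y phi : (0 < N)%N -> 0 <= t <= T -> lip1 phi ->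
  `|\int[fiber A' y]_z (\int[mu t z]_v phi v) -
    \int[fiber A y]_z (\int[mu t z]_v phi v)| <= cell_gap N t y + 2 * (mesh N * b).
Proof.
move=> N0 tT pl.
have h1 := fiber_integral_cells A'1 (M tT) y N0 pl.
have h2 := fiber_integral_cells A1 (M tT) y N0 pl.
set a := \int[fiber A' y]_z _ in h1 *; set c := \int[fiber A y]_z _ in h2 *.
have h3 : `|\sum_(i < N) phi (toCircle (mesh N * i%:R)) *
    \int[fiber A' y]_z fine (mu t z (cell i)) -
    \sum_(i < N) phi (toCircle (mesh N * i%:R)) *
    \int[fiber A y]_z fine (mu t z (cell i))| <= cell_gap N t y.
  rewrite -sumrB (le_trans (ler_norm_sum _ _ _))//; apply: ler_sum => i _.
  by rewrite -mulrBr normrM ler_piMl// pl.1.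
move: h1 h2 h3; rewrite !ler_norml => /andP[? ?] /andP[? ?] /andP[? ?].
by apply/andP; split; lra.
Qed.

(* On [t, t + h] the difference of the two fields is split in four: moving the
   base point from [P'] to [P], replacing [mu'] at the current time by [mu] at
   time [t], replacing the fibers of [A'] by those of [A] (at the fixed time [t],
   so that no measurability in time is needed), and returning to the current
   time. *)
Lemma gap_step (N : nat) (G : Omega -> R) (t h : R) : (0 < N)%N -> bmfun G ->
  (forall y, 0 <= G y) -> 0 <= t -> 0 <= h -> t + h <= T ->
  (forall y x s, 0 <= s <= t -> `|P' y x s - P y x s| <= G y) ->
  forall y x s, 0 <= s <= t + h -> `|P' y x s - P y x s| <=
    G y + h * (L * G y + L * \int[fiber A' y]_z G z +
      C * (cell_gap N t y + 2 * (mesh N * b)) + 4 * L * (L * h)).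
Proof.
move=> N0 bG G0 t0 h0 thT gapG y x s /andP[s0 sth].
set I := \int[fiber A' y]_z G z; set E := cell_gap N t y + _.
have I0 : 0 <= I by apply: Rintegral_ge0 => z _; exact: G0.
have E0 : 0 <= E.
  apply: addr_ge0; first by rewrite /cell_gap sumr_ge0.
  have mN0 : 0 <= mesh N :> R by rewrite divr_ge0// ltW// twopi_gt0.
  by rewrite mulr_ge0// mulr_ge0// ltW.
(* A trajectory moves by at most [L * h] during the step. This displacement is counted four times:
   twice in [e1], once in [e2] and once in [e4]. *)
pose K := L * G y + L * I + C * E + 4 * L * (L * h).
have K0 : 0 <= K by rewrite !addr_ge0// !mulr_ge0// ltW.
rewrite -/K; have [st|/ltW ts] := leP s t.
  by rewrite (le_trans (gapG y x s _)) ?s0// lerDl mulr_ge0.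
have tT : 0 <= t <= T by rewrite t0 (le_trans _ thT)// lerDl.
have [_ Pd' Pt' _ _] := S'; have [_ Pd Pt _ _] := S.
have gap r z x' : t <= r -> r <= t + h -> `|P' z x' r - P z x' t| <= L * h + G z.
  move=> tr rh; rewrite (le_trans (ler_distD (P' z x' t) _ _))//.
  rewrite lerD//; last by apply: gapG; rewrite t0 lexx.
  rewrite (le_trans (Pt' z x' t r t0 tr (le_trans rh thT)))// ler_wpM2l//.
  by rewrite lerBlDl.
have move_P r z x' : t <= r -> r <= t + h -> `|P z x' t - P z x' r| <= L * h.
  move=> tr rh; rewrite distrC.
  rewrite (le_trans (Pt z x' t r t0 tr (le_trans rh thT)))// ler_wpM2l//.
  by rewrite lerBlDl.
pose V' (r : R) u := \int[fiber A' y]_z (\int[mu' r z]_v D (csub v u)).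
pose V (r : R) u := \int[fiber A y]_z (\int[mu r z]_v D (csub v u)).
have key r : t <= r -> r <= t + h ->
    `|C * V' r (toCircle (P' y x r)) - C * V r (toCircle (P y x r))| <= K.
  move=> tr rh; have rT : 0 <= r <= T by rewrite (le_trans t0)//= (le_trans rh).
  have lk u : lip1 (fun v => D (csub v u)) by exact: lip1_kernel.
  set p' := toCircle (P' y x r); set p := toCircle (P y x r).
  have bm1 u : bmfun (fun z => \int[mu' r z]_v D (csub v u)).
    by apply: (bmfun_Rintegral_lip1 (M' rT)).
  have bm2 u : bmfun (fun z => \int[mu t z]_v D (csub v u)).
    by apply: (bmfun_Rintegral_lip1 (M tT)).
  have bm3 u : bmfun (fun z => \int[mu r z]_v D (csub v u)).
    by apply: (bmfun_Rintegral_lip1 (M rT)).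
  have e1 : `|V' r p' - V' r p| <= b * (2 * L * h + G y).
    rewrite -bm_RintegralB//; last exact: fiber_lty.
    rewrite -[leRHS]mulr1; apply: Rintegral_norm_le; first exact: fiber_le1.
      exact: bmfunB.
    move=> z; rewrite -bm_RintegralB; last 3 first.
    - exact: finmeas_lty.
    - exact/lip1_bmfun/lk.
    - exact/lip1_bmfun/lk.
    rewrite mulrC; apply: Rintegral_norm_le; first exact: (M' rT).2.
      by apply: bmfunB; exact/lip1_bmfun/lk.
    move=> v; rewrite (le_trans (D_lip _ _))// (le_trans (mdist_csubr _ _ _))//.
    rewrite (le_trans (mdist_toCircle _ _))//.
    rewrite (le_trans (ler_distD (P y x t) _ _))//.
    have := gap r y x tr rh; have := move_P r y x tr rh; lra.
  have e2 : `|V' r p - \int[fiber A' y]_z (\int[mu t z]_v D (csub v p))| <=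
      b * (L * h + I).
    rewrite -bm_RintegralB//; last exact: fiber_lty.
    have bB := bmfunB (bm1 p) (bm2 p).
    apply: le_trans (bm_norm_Rintegral (fiber_lty A'1 y) bB) _.
    apply: (@le_trans _ _ (\int[fiber A' y]_z (b * (L * h + G z)))).
      apply: bm_le_Rintegral; first exact: fiber_lty.
      - exact: bmfun_norm.
      - by apply: bmfunZ; apply: bmfunD => //; exact: bmfun_cst.
      by move=> z; rewrite mulrC; apply: (transport_gap S' S) => // x'; exact: gap.
    rewrite bm_RintegralZ; [|exact: fiber_lty|by apply: bmfunD => //; exact: bmfun_cst].
    rewrite ler_wpM2l ?(ltW b0)// bm_RintegralD//; [|exact: fiber_lty|exact: bmfun_cst].
    rewrite lerD2r (le_trans (ler_norm _))// -[leRHS]mulr1.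
    apply: Rintegral_norm_le; [exact: fiber_le1|exact: bmfun_cst|move=> _].
    by rewrite ger0_norm// mulr_ge0.
  have e3 := fiber_diff y N0 tT (lk p).
  have e4 : `|\int[fiber A y]_z (\int[mu t z]_v D (csub v p)) - V r p| <= b * (L * h).
    rewrite -bm_RintegralB//; last exact: fiber_lty.
    rewrite -[leRHS]mulr1; apply: Rintegral_norm_le; first exact: fiber_le1.
      exact: bmfunB.
    by move=> z; rewrite mulrC; apply: (transport_gap S S) => // x'; exact: move_P.
  rewrite -mulrBr normrM gtr0_norm//.
  have -> : K = C * (b * (2 * L * h + G y) + b * (L * h + I) + E + b * (L * h)).
    by rewrite /K /L; ring.
  rewrite ler_pM2l//; move: e1 e2 e3 e4; rewrite -/E.
  move: (V' r p') (V' r p) (V r p) (\int[fiber A' y]_z _) (\int[fiber A y]_z _).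
  move=> a1 a2 a3 a4 a5; rewrite !ler_norml.
  move=> /andP[? ?] /andP[? ?] /andP[? ?] /andP[? ?].
  by apply/andP; split; lra.
have sub r : t <= r <= s -> 0 <= r <= T.
  by move=> /andP[tr rs]; rewrite (le_trans t0)//= (le_trans rs)// (le_trans sth).
have D1 r : t <= r <= s -> is_derive r 1 (P' y x \- P y x)
    (C * V' r (toCircle (P' y x r)) - C * V r (toCircle (P y x r))).
  by move=> /sub rT; apply: is_deriveB; [exact: Pd'|exact: Pd].
have : `|(P' y x \- P y x) s - (P' y x \- P y x) t| <= K * s - K * t.
  apply: (@dist_le_primitive _ (P' y x \- P y x)
      (fun r => C * V' r (toCircle (P' y x r)) - C * V r (toCircle (P y x r)))
      (fun r => K * r) (fun=> K) t s ts).
  - apply: derivable_within_continuous => u; rewrite in_itv/= => uT.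
    exact: (@ex_derive _ _ _ _ _ _ _ (D1 u uT)).
  - by apply: continuous_subspaceT => u; apply: cvgM; [exact: cvg_cst|exact: cvg_id].
  - by move=> u; rewrite in_itv/= => /andP[/ltW tu /ltW us]; apply: D1; rewrite tu.
  - by move=> u _; apply: is_derive_eq; rewrite /GRing.scale/= mulr1.
  - move=> u; rewrite in_itv/= => /andP[/ltW tu /ltW us]; apply: key => //.
    exact: le_trans sth.
rewrite -mulrBr /= => h1.
have h2 : K * (s - t) <= h * K by rewrite mulrC ler_wpM2r// lerBlDl.
have := gapG y x t; rewrite t0 lexx => /(_ isT) h3.
move: h1 h3; rewrite !ler_norml => /andP[? ?] /andP[? ?].
by apply/andP; split; lra.
Qed.

End gap.

Section cell_gap_measurable.
Context {d} {Omega : measurableType d} {R : realType}.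
Variables (m : probability Omega R) (b : R).
Variables (A' A : graphop m) (mu : R -> Omega -> finmeas R).
Hypotheses (A'1 : (gamma A' <= 1)%E) (A1 : (gamma A <= 1)%E).

Lemma bmfun_cell_gap N t : (0 < N)%N ->
  Mbar b (mu t) -> bmfun (cell_gap A' A mu N t).
Proof.
move=> N0 M; apply: bmfun_sum => i; apply: bmfun_norm.
have bF := bmfun_finmeas M (measurable_cell N0 i).
by apply: bmfunB; exact: bmfun_fiber.
Qed.

End cell_gap_measurable.

(** * Discrete Gronwall lemma *)

Section discrete_gronwall.
Context {R : realType}.

(** One step multiplies by [1 + h * c], at most [expR (h * c)]. The grid version asks for no
    regularity of the integrated gap in time. *)
Lemma discrete_gronwall (a : nat -> R) (K : nat) (c h e : R) :
  0 <= c -> 0 <= h -> 0 <= e -> a 0 <= 0 ->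
  (forall j, (j < K)%N -> a j.+1 <= a j + h * (c * a j + e)) ->
  forall j, (j <= K)%N -> a j <= e * (j%:R * h) * expR (c * (j%:R * h)).
Proof.
move=> c0 h0 e0 a0 step; elim=> [|j ih] jK; first by rewrite mul0r mulr0 mul0r.
have {ih} ih := ih (ltnW jK).
rewrite (le_trans (step j jK))//.
have hc : 0 <= h * c by rewrite mulr_ge0.
have E : expR (c * (j.+1%:R * h)) = expR (h * c) * expR (c * (j%:R * h)).
  by rewrite -expRD; congr expR; rewrite -natr1; ring.
have e1 : 1 + h * c <= expR (h * c) by exact: expR_ge1Dx.
have e2 : 1 <= expR (c * (j.+1%:R * h)) by rewrite -expR0 ler_expR !mulr_ge0.
have -> : a j + h * (c * a j + e) = (1 + h * c) * a j + h * e by ring.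
have -> : e * (j.+1%:R * h) * expR (c * (j.+1%:R * h)) =
    expR (h * c) * (e * (j%:R * h) * expR (c * (j%:R * h))) +
    h * e * expR (c * (j.+1%:R * h)).
  by rewrite E -natr1; ring.
rewrite lerD//; last by rewrite ler_peMr// mulr_ge0.
rewrite (le_trans (ler_wpM2l _ ih)) ?addr_ge0// ler_wpM2r// !mulr_ge0// expR_ge0.
Qed.

Lemma exists_divr_le (x e : R) : 0 < e -> exists2 K : nat, (0 < K)%N & x / K%:R <= e.
Proof.
move=> e0; exists (Num.truncn (x / e)).+1 => //.
rewrite ler_pdivrMr ?ltr0n// mulrC -ler_pdivrMr//.
by rewrite ltW// truncnS_gt.
Qed.

Lemma cvg_sumr {T I : Type} {F : set_system T} {FF : Filter F} (s : seq I)
    (f : I -> T -> R) (l : I -> R) : (forall i, f i x @[x --> F] --> l i) ->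
  \sum_(i <- s) f i x @[x --> F] --> \sum_(i <- s) l i.
Proof.
move=> fl; elim: s => [|i s ih].
  by rewrite big_nil; under eq_cvg do rewrite big_nil; exact: cvg_cst.
by rewrite big_cons; under eq_cvg do rewrite big_cons; exact: cvgD.
Qed.

End discrete_gronwall.

(** * Convergence of the sources *)

Section cell_gap_convergence.
Context {d} {R : realType} {Omega : borelMetricType d R}.
Variables (m : probability Omega R) (b : R).
Variables (A_ : nat -> graphop m) (A : graphop m) (mu : R -> Omega -> finmeas R).
Hypotheses (A_1 : forall n, (gamma (A_ n) <= 1)%E) (A1 : (gamma A <= 1)%E).
Hypothesis AA : graphop_cvg A_ A.

Lemma cell_gap_cvg N t : (0 < N)%N -> Mbar b (mu t) ->
  (forall S, measurable S -> lambda (boundary S) = 0%E ->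
    m [set x | ~ {for x, continuous (fun y => fine (mu t y S))}] = 0%E) ->
  \int[m]_y cell_gap (A_ n) A mu N t y @[n --> \oo] --> (0 : R).
Proof.
move=> N0 M cont; pose g (i : 'I_N) z := fine (mu t z (cell i)).
have bg i : bmfun (g i) := bmfun_finmeas M (measurable_cell N0 i).
have g_le i z : `|g i z| <= b.
  rewrite ger0_norm ?fine_ge0// -lee_fin fineK; last first.
    by rewrite fin_num_measure//; exact: measurable_cell.
  by apply: le_trans (M.2 z); apply: le_measure => //; rewrite inE//; exact: measurable_cell.
have -> : (0 : R) = \int[m]_y 0 by rewrite Rintegral_cst// mul0r.
apply: (@Rintegral_bounded_cvg _ _ _ _ _ _ (\sum_(i < N) (b * 1 + b * 1))).
- exact: prob_lty.
- by move=> n; case: (bmfun_cell_gap (A_1 n) A1 N0 M).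
- exact: bmfun_cst.
- move=> n y; rewrite ger0_norm ?sumr_ge0//; apply: ler_sum => i _.
  rewrite (le_trans (ler_normB _ _))//.
  by rewrite lerD//; [exact: (Rintegral_norm_le (fiber_le1 (A_1 n) y) (bg i) (g_le i))|
    exact: (Rintegral_norm_le (fiber_le1 A1 y) (bg i) (g_le i))].
(* The null sets given by [fiber_null] for the different cells have a null union because there are
   only [N] cells. *)
have cae : {ae m, forall y, forall i, fiber A y [set x | ~ {for x, continuous (g i)}] = 0%E}.
  apply: filter_forall => i; apply: fiber_null => //.
    exact: measurable_discontinuities.
  by apply: cont; [exact: measurable_cell|exact: lambda_boundary_cell].
apply: filterS2 AA cae => y wy cy.
have E : \sum_(i < N) `|\int[fiber A y]_z g i z - \int[fiber A y]_z g i z| = 0.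
  by rewrite big1// => i _; rewrite subrr normr0.
rewrite -[X in _ --> X]E /cell_gap.
apply: cvg_sumr => i.
apply: cvg_norm; apply: cvgB; last exact: cvg_cst.
apply: (weak_cvg_ae_continuous (fun n => fiber_lty (A_1 n) y) (fiber_lty A1 y) wy (bg i)).
exists [set x | ~ {for x, continuous (g i)}]; split => //.
exact: measurable_discontinuities.
Qed.

End cell_gap_convergence.

(** * The recursion on the time grid *)

Section dbarm_bound.
Context {d} {Omega : measurableType d} {R : realType}.
Variables (m : probability Omega R) (T b C : R) (D : circle R -> R).
Variable mu0 : Omega -> finmeas R.
Hypotheses (T0 : 0 < T) (b0 : 0 < b) (C0 : 0 < C).
Hypothesis D_lip : forall u v, `|D u - D v| <= mdist u v.
Hypothesis D_bd : forall u, `|D u| <= 1.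
Hypothesis mu0M : Mbar b mu0.
Variables (A' A : graphop m) (mu' mu : R -> Omega -> finmeas R).
Variables (P' P : Omega -> R -> R -> R).
Hypotheses (A'1 : (gamma A' <= 1)%E) (A1 : (gamma A <= 1)%E).
Hypotheses (S' : solution_lift T b C D A' mu0 mu' P')
  (S : solution_lift T b C D A mu0 mu P).
Hypotheses (mu'M : MbarT b T mu') (muM : MbarT b T mu).
Let L := C * b.

Variables (K N : nat).
Hypotheses (K0 : (0 < K)%N) (N0 : (0 < N)%N).
Let h := T / K%:R.

Let L0 : 0 <= L. Proof. by rewrite mulr_ge0 ?ltW. Qed.

Let h0 : 0 <= h. Proof. by rewrite divr_ge0// ltW. Qed.

Let Kh : K%:R * h = T.
Proof. by rewrite mulrC divfK// pnatr_eq0 -lt0n. Qed.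

Let time j : (j <= K)%N -> 0 <= j%:R * h <= T.
Proof.
by move=> jK; rewrite mulr_ge0//= -Kh ler_wpM2r// ler_nat.
Qed.

Let mesh0 : 0 <= mesh N :> R.
Proof. by rewrite divr_ge0// ltW// twopi_gt0. Qed.

Let source j y : R :=
  C * (cell_gap A' A mu N (j%:R * h) y + 2 * (mesh N * b)) + 4 * L * (L * h).

Let source_ge0 j y : 0 <= source j y.
Proof.
apply: addr_ge0; last by apply: mulr_ge0; apply: mulr_ge0.
apply: mulr_ge0; first exact: ltW.
apply: addr_ge0; first by rewrite /cell_gap sumr_ge0.
by rewrite mulr_ge0// mulr_ge0// ltW.
Qed.

Let bm_source j : (j <= K)%N -> bmfun (source j).
Proof.
move=> jK; apply: bmfunD; last exact: bmfun_cst.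
apply: bmfunZ; apply: bmfunD; last exact: bmfun_cst.
by apply: (bmfun_cell_gap A'1 A1 N0); apply: (muM (time jK)).1.
Qed.

(* The iterated right-hand sides of [gap_step], started from the zero gap. *)
Fixpoint gap_bound (j : nat) (y : Omega) : R :=
  if j is k.+1 then gap_bound k y + h * (L * gap_bound k y +
    L * \int[fiber A' y]_z gap_bound k z + source k y)
  else 0.

Let gap_bound_ge0 j y : 0 <= gap_bound j y.
Proof.
elim: j y => [//|j ih] y /=.
apply: addr_ge0 => //; apply: mulr_ge0 => //; apply: addr_ge0 => //.
apply: addr_ge0; first by rewrite mulr_ge0.
by rewrite mulr_ge0// Rintegral_ge0.
Qed.

Let bm_gap_bound j : (j <= K)%N -> bmfun (gap_bound j).
Proof.
elim: j => [_|j ih jK]; first exact: bmfun_cst.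
have bj := ih (ltnW jK).
apply: bmfunD => //; apply: bmfunZ; apply: bmfunD; last exact/bm_source/ltnW.
by apply: bmfunD; apply: bmfunZ => //; exact: bmfun_fiber.
Qed.

Let gap_boundP j : (j <= K)%N -> forall y x s, 0 <= s <= j%:R * h ->
  `|P' y x s - P y x s| <= gap_bound j y.
Proof.
elim: j => [_|j ih jK] y x s.
  rewrite mul0r -eq_le => /eqP <-.
  by have [-> _ _ _ _] := S'; have [-> _ _ _ _] := S; rewrite subrr normr0.
have jh : j.+1%:R * h = j%:R * h + h by rewrite -natr1 mulrDl mul1r.
have /andP[_ jT] := time jK; have /andP[j0 _] := time (ltnW jK).
rewrite jh in jT *.
have := gap_step b0 C0 D_lip D_bd mu0M A'1 A1 S' S mu'M muM N0
  (bm_gap_bound (ltnW jK)) (gap_bound_ge0 j) j0 h0 jT (ih (ltnW jK)).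
by move=> /(_ y x s) /[apply]; rewrite /= /source !addrA.
Qed.

Variable e : R.
Hypothesis cells_le : forall j, (j < K)%N ->
  C * \int[m]_y cell_gap A' A mu N (j%:R * h) y <= e / 3.
Hypothesis mesh_le : C * (2 * (mesh N * b)) <= e / 3.
Hypothesis step_le : 4 * L * (L * h) <= e / 3.

Let e0 : 0 <= e.
Proof.
have : 0 <= e / 3 by apply: le_trans step_le; apply: mulr_ge0; apply: mulr_ge0.
by rewrite pmulr_lge0// invr_gt0.
Qed.

Let Rintegral_source_le j : (j < K)%N -> \int[m]_y source j y <= e.
Proof.
move=> jK; have bc : bmfun (cell_gap A' A mu N (j%:R * h)).
  by apply: (bmfun_cell_gap A'1 A1 N0); apply: (muM (time (ltnW jK))).1.
have p1 : (m setT < +oo)%E by exact: prob_lty.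
have cstE c : \int[m]_y c = c :> R.
  transitivity (c * fine (m setT)); first exact: Rintegral_cst.
  by rewrite probability_setT mulr1.
rewrite bm_RintegralD//; [|by apply: bmfunZ; apply: bmfunD => //; exact: bmfun_cst|
  exact: bmfun_cst].
rewrite bm_RintegralZ//; last by apply: bmfunD => //; exact: bmfun_cst.
rewrite bm_RintegralD//; last exact: bmfun_cst.
rewrite !cstE mulrDr.
have := cells_le jK; have := mesh_le; have := step_le.
by move: (C * _) (C * _) (4 * _ * _) => a1 a2 a3; lra.
Qed.

Let Rintegral_gap_bound_le :
  \int[m]_y gap_bound K y <= e * T * expR (2 * L * T).
Proof.
rewrite -[X in e * X]Kh -[X in expR (_ * X)]Kh.
(* The rate is [2 * L] because, after integration against [m], the local term and the fiber term
   each contribute at most [L] times the integral of [gap_bound j]. *)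
apply: (@discrete_gronwall R (fun j => \int[m]_y gap_bound j y) K) => //.
  by rewrite mulr_ge0.
  by rewrite Rintegral_cst// mul0r.
move=> j jK; have bj := bm_gap_bound (ltnW jK).
have p1 : (m setT < +oo)%E by exact: prob_lty.
have bf := bmfun_fiber A'1 bj; have bs := bm_source (ltnW jK).
have b1 := bmfunZ L bj; have b2 := bmfunZ L bf.
have b3 := bmfunD b1 b2; have b4 := bmfunD b3 bs.
rewrite /= bm_RintegralD//; last exact: bmfunZ.
rewrite lerD2l bm_RintegralZ// ler_wpM2l//.
rewrite bm_RintegralD// lerD ?Rintegral_source_le//.
rewrite bm_RintegralD// !bm_RintegralZ//.
rewrite -mulrA mulr_natl mulr2n lerD2l.
exact: ler_wpM2l L0 _ _ (Rintegral_fiber_le A'1 bj (gap_bound_ge0 j)).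
Qed.

(** The last function [gap_bound K] dominates the gap on all of [0, T], so the bound does not depend
    on [t] and passes to the supremum over times. *)
Lemma dbarm_le t : 0 <= t <= T ->
  (dbarm m (mu' t) (mu t) <= (b * (e * T * expR (2 * L * T)))%:E)%E.
Proof.
move=> tT; have bK := bm_gap_bound (leqnn K).
apply: (@le_trans _ _ (\int[m]_y (gap_bound K y * b)%:E)%E).
  apply: ge0_le_lower_integral => y; first exact: dBL_ge0.
  apply: (dBL_gap mu0M S' S tT) => x.
  by apply: gap_boundP => //; rewrite Kh.
have bKb := bmfunM bK (bmfun_cst b).
rewrite -EFin_Rintegral//; last exact: prob_lty.
rewrite lee_fin.
have -> : \int[m]_y (gap_bound K y * b) = b * \int[m]_y gap_bound K y.
  rewrite -bm_RintegralZ//; last exact: prob_lty.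
  by apply: eq_Rintegral => y _; rewrite mulrC.
rewrite ler_wpM2l ?(ltW b0)//; exact: Rintegral_gap_bound_le.
Qed.

End dbarm_bound.

(** * Choice of the parameters and passage to the limit *)

Theorem proposition3p2 (R : realType) (d : measure_display)
    (Omega : borelMetricType d R) (m : probability Omega R)
    (T b C : R) (D : circle R -> R)
    (A_ : nat -> graphop m) (A : graphop m)
    (mu0 : Omega -> finmeas R)
    (mu_ : nat -> R -> Omega -> finmeas R) (mu : R -> Omega -> finmeas R) :
  compact [set: Omega] ->
  0 < T -> 0 < b -> 0 < C ->
  (forall u v, `|D u - D v| <= mdist u v) ->
  (forall u, `|D u| <= 1) ->
  (forall n, (gamma (A_ n) <= 1)%E) ->
  (gamma A <= 1)%E ->
  Mbar b mu0 ->
  (forall n, MbarT b T (mu_ n) /\ fixed_point T C D (A_ n) mu0 (mu_ n)) ->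
  MbarT b T mu /\ fixed_point T C D A mu0 mu ->
  graphop_cvg A_ A ->
  (exists2 q : \bar R, (1 <= q)%E & (opnorm (graphop_fun A) 1 q < +oo)%E) ->
  (forall (S : set (circle R)) (t : R),
     measurable S -> lambda (boundary S) = 0%E -> 0 <= t <= T ->
     let g := fun x => fine (mu t x S) in
     [bounded g x | x in [set: Omega]] /\
     m [set x | ~ {for x, continuous g}] = 0%E) ->
  ereal_sup [set dbarm m (mu_ n t) (mu t) | t in `[0, T]] @[n --> \oo] --> 0%E.
Proof.
move=> _ T0 b0 C0 D_lip D_bd A_1 A1 mu0M mu_S [muM muF] AA _ cont.
have /choice[P_ P_S] n : exists Q, solution_lift T b C D (A_ n) mu0 (mu_ n) Q.
  have [muM' muF'] := mu_S n.
  exact: (solution_flow T0 b0 C0 D_lip D_bd (A_1 n) muM' muF').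
have [P PS] := solution_flow T0 b0 C0 D_lip D_bd A1 muM muF.
pose L := C * b; pose Z := b * (T * expR (2 * L * T)).
have L0 : 0 < L by exact: mulr_gt0.
have Z0 : 0 < Z by rewrite !mulr_gt0// expR_gt0.
have main (eps : R) : 0 < eps -> \forall n \near \oo,
    (ereal_sup [set dbarm m (mu_ n t) (mu t) | t in `[0%R, T]] <= eps%:E)%E.
  (* [dbarm_le] yields the bound [e * Z]. The budget [e] is shared by three errors: [K] settles the
     time step and [N] the mesh, both independently of [n], and the cell gaps at the finitely many
     grid times take the last third for large [n]. *)
  move=> eps0; pose e := eps / Z; have e0 : 0 < e / 3 by rewrite !divr_gt0.
  have [K K0 KE] := exists_divr_le (4 * L * (L * T)) e0.
  have [N N0 NE] := exists_divr_le (C * (2 * (2 * pi * b))) e0.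
  pose h := T / K%:R.
  have tK (j : 'I_K) : 0 <= j%:R * h <= T.
    rewrite mulr_ge0 ?divr_ge0 ?(ltW T0)//= mulrCA ler_piMr ?(ltW T0)//.
    by rewrite ler_pdivrMr ?ltr0n// mul1r ler_nat ltnW.
  have near_cells : \forall n \near \oo, forall j : 'I_K,
      C * \int[m]_y cell_gap (A_ n) A mu N (j%:R * h) y <= e / 3.
    apply: filter_forall => j.
    have c0 : 0 < e / 3 / C by rewrite divr_gt0.
    have := cell_gap_cvg A_1 A1 AA N0 (muM _ (tK j)).1
      (fun S mS bS => (cont S _ mS bS (tK j)).2).
    move=> /cvgrPdist_le/(_ _ c0); apply: filterS => n.
    rewrite sub0r normrN => /(le_trans (ler_norm _)).
    by rewrite ler_pdivlMr// mulrC.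
  apply: filterS near_cells => n cells; apply: ge_ereal_sup => _ [t tT <-].
  have epsE : eps = b * (e * T * expR (2 * L * T)).
    by rewrite /e /Z; field; rewrite !gt_eqF ?expR_gt0.
  rewrite epsE; apply: (dbarm_le T0 b0 C0 D_lip D_bd mu0M (A_1 n) A1 (P_S n) PS _ muM K0 N0).
  - exact: (mu_S n).1.
  - by move=> j jK; exact: (cells (Ordinal jK)).
  - by move: NE; rewrite /mesh; congr (_ <= _); ring.
  - by move: KE; rewrite /h -/L; congr (_ <= _); ring.
  - by move: tT; rewrite /= in_itv.
have sup0 n : (0 <= ereal_sup [set dbarm m (mu_ n t) (mu t) | t in `[0%R, T]])%E.
  apply: (@le_trans _ _ (dbarm m (mu_ n 0) (mu 0))).
    by apply: integral_ge0 => y _; exact: dBL_ge0.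
  by apply: ereal_sup_ubound; exists 0 => //=; rewrite in_itv/= lexx ltW.
apply/fine_cvgP; split.
  apply: filterS (main 1 ltr01) => n h1.
  by rewrite ge0_fin_numE// (le_lt_trans h1)// ltry.
apply/cvgrPdist_le => eps eps0; apply: filterS (main eps eps0) => n h1.
rewrite sub0r normrN ger0_norm ?fine_ge0// -lee_fin fineK//.
by rewrite ge0_fin_numE// (le_lt_trans h1)// ltry.
Qed.
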